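(* There is an absolute constant $C>0$ such that the following holds. Let $G$ be a uniformly random simple $d$-regular graph on $n$ vertices. Let $\mathcal{I}$ be a collection of cycles in the complete graph $K_n$ (on the same vertex set) of maximum length $r$, and let $\mathbf{I}=(I_\alpha,\ \alpha\in\mathcal{I})$ with $I_\alpha=\mathbf{1}\{G\text{ contains }\alpha\}$. Let $\mathbf{Z}=(Z_\alpha,\ \alpha\in\mathcal{I})$ be a vector of independent Poisson random variables with $\mathbb{E}Z_\alpha=(d-1)^{|\alpha|}/[n]_{|\alpha|}$, where $|\alpha|$ is the length of $\alpha$. Then for all $n$ and all $d,r\geq 3$ with $r\leq n^{1/10}$ and $d\leq n^{1/3}$, \[ d_{TV}(\mathbf{I},\mathbf{Z})\leq \sum_{\alpha\in\mathcal{I}}\frac{C\,|\alpha|(d-1)^{|\alpha|+r-1}}{n^{|\alpha|+1}}. \]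
   Context: A random $d$-regular graph on $n$ vertices is chosen uniformly from all simple $d$-regular graphs on $\{1,\dots,n\}$ (with $n$ even when $d$ is odd). Cycles are simple cycles. $[n]_k=n(n-1)\cdots(n-k+1)$. For random vectors $X,Y$ with values in a countable set $S$, $d_{TV}(X,Y)=\sup_{A\subset S}|\mathbb{P}[X\in A]-\mathbb{P}[Y\in A]|$. *)

(* Defs.v *)
From HB Require Import structures.
From mathcomp Require Import all_boot all_order all_algebra.

Set Implicit Arguments.
Unset Strict Implicit.
Unset Printing Implicit Defensive.

(* Subgraphs of K_n, and in particular cycles, are identified with their edge
   sets; the vertex set {1, ..., n} is represented by 'I_n. *)
Definition edge_set (n : nat) : Type := {set {set 'I_n}}.
HB.instance Definition _ n := Finite.on (edge_set n).

Section Graphs.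
Variable n : nat.
Implicit Types (E : edge_set n) (c : seq 'I_n).

Definition simple_graph E : bool := [forall e in E, #|e| == 2].

Definition degree E (v : 'I_n) : nat := #|[set e in E | v \in e]|.

Definition is_regular (d : nat) E : bool :=
  simple_graph E && [forall v, degree E v == d].

Definition regular_graphs (d : nat) : {set edge_set n} :=
  [set E : edge_set n | is_regular d E].

(* c = [:: v_1; ...; v_k] gives {v_1,v_2}, ..., {v_{k-1},v_k}, {v_k,v_1}. *)
Definition cycle_edges c : edge_set n := [set [set v; next c v] | v in c].

Definition is_cycle E : Prop :=
  exists c, [/\ uniq c, 3 <= size c & E = cycle_edges c].

Definition cycle_length E : nat := #|E|.

Definition contains (G E : edge_set n) : bool := E \subset G.

End Graphs.

From mathcomp Require Import all_classical all_reals all_analysis.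

Import Order.TTheory GRing.Theory Num.Theory.
Local Open Scope classical_set_scope.
Local Open Scope ring_scope.

Section Probability.
Context {R : realType} {dO : measure_display} {Omega : measurableType dO}.
Variable P : probability Omega R.

Definition uniform_on (S : finType) (B : {set S}) (X : Omega -> S) : Prop :=
  forall x : S, measurable (X @^-1` [set x]) /\
    P (X @^-1` [set x]) = (if x \in B then (#|B|%:R)^-1 else 0)%:E.

Definition is_poisson (X : {RV P >-> nat}) : Prop :=
  exists2 rate : R, 0 < rate &
    forall k, P (X @^-1` [set k]) = (poisson_pmf rate k)%:E.

Definition mutually_independent (I : finType) (X : I -> {RV P >-> nat}) : Prop :=
  forall (J : {set I}) (A : I -> set nat),
    P (\bigcap_(i in [set i | i \in J]) (X i @^-1` A i)) =
    (\prod_(i in J) P (X i @^-1` A i))%E.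

End Probability.

(* Meaningful when X and Y are measurable for the discrete sigma-algebra on S;
   the supremum is over a nonempty set of reals bounded by 1. *)
Definition dTV {R : realType} {dO dO2 : measure_display}
    {Omega : measurableType dO} {Omega2 : measurableType dO2}
    (P : probability Omega R) (Q : probability Omega2 R)
    (S : countType) (X : Omega -> S) (Y : Omega2 -> S) : R :=
  sup [set `|fine (P (X @^-1` A)) - fine (Q (Y @^-1` A))| | A in [set: set S]].

Section Vectors.
Variables (n : nat) (cI : {set edge_set n}) (T : Type).

Definition cycle_index : finType := {alpha : edge_set n | alpha \in cI}.

Definition cycle_indicators (G : T -> edge_set n) (w : T) : {ffun cycle_index -> nat} :=
  [ffun alpha : cycle_index => nat_of_bool (contains (G w) (val alpha))].

Definition joint_vector (Z : cycle_index -> T -> nat) (w : T) : {ffun cycle_index -> nat} :=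
  [ffun alpha => Z alpha w].

End Vectors.

(* Main.v *)
Require Import Defs.
From mathcomp Require Import all_boot all_order all_algebra.
From mathcomp Require Import zify ring lra.

Set Implicit Arguments.
Unset Strict Implicit.
Unset Printing Implicit Defensive.

Import Order.TTheory GRing.Theory Num.Theory.
Local Open Scope ring_scope.

(** Inserting an edge [xy] into a regular graph that contains a fixed edge set [F]
    is a 2-switch: [xu] and [yw] are replaced by [xy] and [uw].  Counting these
    switches from both sides shows that requiring [xy] besides [F] multiplies the
    number of graphs by about [(d - deg_F x) (d - deg_F y) / (n d)], and inserting
    the edges of a cycle [alpha] one at a time by [((d - 1) / n) ^ |alpha|].  A
    switch changes the indicator of some other short cycle only if that cycle uses
    one of the four edges involved; closing such a cycle at a suitable edge outside
    [F] gains a factor [O(d / n)] over the number of paths leading to it, so the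
    proportion of these switches is [O((d - 1) ^ (r - 1) / n)].  Hence for every
    bounded [h] depending only on the other cycles, [E (h; alpha in G)] is
    [lambda_alpha E h] up to a relative error [O(|alpha| (d - 1) ^ (r - 1) / n)].
    This allows the indicators to be replaced by independent Poisson variables one
    coordinate at a time. *)

(** * Simple and regular graphs *)

Lemma eq_set2 (T : finType) (a b c e : T) :
  ([set a; b] == [set c; e]) = (a == c) && (b == e) || (a == e) && (b == c).
Proof.
apply/eqP/orP => [eq_abce|[] /andP[/eqP-> /eqP->]]; rewrite // 1?[RHS]setUC //.
have: a \in [set c; e] by rewrite -eq_abce set21.
have: b \in [set c; e] by rewrite -eq_abce set22.
have: c \in [set a; b] by rewrite eq_abce set21.
have: e \in [set a; b] by rewrite eq_abce set22.
rewrite !inE ![c == _]eq_sym ![e == _]eq_sym.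
by case: (a == c); case: (b == e); case: (a == e); case: (b == c) => //=; auto.
Qed.

Lemma in_set2_add (T : finType) (a b v : T) : a != b ->
  (v \in [set a; b] = (v == a) + (v == b) :> nat)%N.
Proof. by move=> ab; rewrite in_set2; case: eqP => [->|]; rewrite ?(negPf ab). Qed.

Section SimpleGraphs.
Variable n : nat.
Implicit Types (f : {set 'I_n}) (F G : edge_set n).

Lemma simple_subset F G : F \subset G -> simple_graph G -> simple_graph F.
Proof.
by move=> /subsetP FG /forall_inP simpleG; apply/forall_inP => f /FG; apply: simpleG.
Qed.

Lemma simple_edge_neq G a b : simple_graph G -> [set a; b] \in G -> a != b.
Proof. by move=> /forall_inP simpleG /simpleG; rewrite cards2; case: (a == b). Qed.

Lemma degree_sum F v : degree F v = (\sum_(f in F) (v \in f))%N.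
Proof.
rewrite /degree -sum1_card big_mkcond [RHS]big_mkcond /=.
by apply: eq_bigr => f _; rewrite inE; case: (f \in F); case: (v \in f).
Qed.

Lemma degree_setU1 F f v : f \notin F -> degree (f |: F) v = ((v \in f) + degree F v)%N.
Proof. by move=> fF; rewrite !degree_sum big_setU1. Qed.

Lemma degree_setD1 F f v : f \in F -> degree F v = ((v \in f) + degree (F :\ f) v)%N.
Proof. by move=> fF; rewrite !degree_sum (big_setD1 f). Qed.

Lemma degree_subset F G v : F \subset G -> (degree F v <= degree G v)%N.
Proof.
move=> FG; apply: subset_leq_card; apply/subsetP => f.
by rewrite !inE => /andP[/(subsetP FG)-> ->].
Qed.

Lemma sum_adjacent G u : simple_graph G ->
  (\sum_w ([set u; w] \in G) = degree G u)%N.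
Proof.
move=> simpleG.
have -> : (\sum_w ([set u; w] \in G) = #|[set w | [set u; w] \in G]|)%N.
  by rewrite -sum1_card [RHS]big_mkcond /=; apply: eq_bigr => w _; rewrite inE; case: ifP.
rewrite /degree -[LHS](card_in_imset (f := fun w => [set u; w])); last first.
  move=> w w' _ _ /eqP; rewrite eq_set2 eqxx /=.
  by case/orP=> [/eqP//|/andP[/eqP<- /eqP->]].
congr #|pred_of_set _|; apply/setP => f; rewrite !inE; apply/imsetP/andP.
  by case=> w; rewrite inE => uwG ->; rewrite set21.
case=> fG uf; have := forall_inP simpleG f fG.
rewrite (cardsD1 u f) uf add1n eqSS => /cards1P[w f_minus_u].
by exists w; rewrite ?inE -f_minus_u setD1K.
Qed.

Lemma sum_adjacent_setD G F u : simple_graph G -> F \subset G ->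
  (\sum_w ([set u; w] \in G :\: F) = degree G u - degree F u)%N.
Proof.
move=> simpleG FG; rewrite -!sum_adjacent ?(simple_subset FG) //.
rewrite -sumnB => [|w _]; last by case: (boolP (_ \in F)) => // /(subsetP FG) ->.
apply: eq_bigr => w _; rewrite inE.
by case: (boolP (_ \in F)) => [/(subsetP FG) ->|_]; rewrite ?subn0.
Qed.

Lemma handshake G : simple_graph G -> (\sum_u degree G u = 2 * #|G|)%N.
Proof.
move=> simpleG; under eq_bigr do rewrite degree_sum.
rewrite exchange_big /= -sum1_card big_distrr /=; apply: eq_bigr => f fG.
rewrite muln1 -(eqP (forall_inP simpleG f fG)) -sum1_card [RHS]big_mkcond.
by apply: eq_bigr => u _; case: (u \in f).
Qed.

Variable d : nat.

Lemma regular_simple G : G \in regular_graphs n d -> simple_graph G.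
Proof. by rewrite inE => /andP[]. Qed.

Lemma regular_degree G v : G \in regular_graphs n d -> degree G v = d.
Proof. by rewrite inE => /andP[_ /forallP/(_ v)/eqP]. Qed.

Lemma sum_adjacent_regular G u : G \in regular_graphs n d ->
  (\sum_w ([set u; w] \in G) = d)%N.
Proof. by move=> regG; rewrite sum_adjacent ?(regular_simple regG) ?regular_degree. Qed.

End SimpleGraphs.

(** * Switchings *)

Section Switching.
Variables (n d : nat).
Implicit Types (a b c e u v w x y : 'I_n) (F G : edge_set n).

Definition switch a b c e G : edge_set n :=
  [set a; c] |: ([set b; e] |: ((G :\ [set a; b]) :\ [set c; e])).

(* Exchanging [b] and [c] turns this condition into the one for the inverse switch. *)
Definition switchable F a b c e G : bool :=
  [&& G \in regular_graphs n d, F \subset G & uniq [:: a; b; c; e]] &&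
  [&& [set a; b] \in G :\: F, [set c; e] \in G :\: F,
      [set a; c] \notin G & [set b; e] \notin G].

Lemma switchableP F a b c e G : switchable F a b c e G ->
  [/\ G \in regular_graphs n d, F \subset G, uniq [:: a; b; c; e],
      [/\ [set a; b] \in G, [set a; b] \notin F, [set c; e] \in G
        & [set c; e] \notin F]
    & [set a; c] \notin G /\ [set b; e] \notin G].
Proof.
case/andP=> /and3P[-> -> ->] /and4P[].
by rewrite 2!in_setD => /andP[-> ->] /andP[-> ->] -> ->.
Qed.

Lemma switchable_sym F a b c e G : switchable F a b c e G = switchable F c e a b G.
Proof.
rewrite /switchable [[set c; a]]setUC [[set e; b]]setUC.
rewrite -(uniq_catC [:: a; b] [:: c; e]).
by congr (_ && _); rewrite andbCA.
Qed.

Lemma in_switch a b c e G f :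
  f \in switch a b c e G = [|| f == [set a; c], f == [set b; e] |
    [&& f != [set c; e], f != [set a; b] & f \in G]].
Proof. by rewrite !inE. Qed.

Lemma uniq4_set2 a b c e : uniq [:: a; b; c; e] ->
  [/\ [set a; b] != [set c; e], [set a; b] != [set a; c],
      [set a; b] != [set b; e], [set c; e] != [set a; c]
    & [/\ [set c; e] != [set b; e] & [set a; c] != [set b; e]]].
Proof.
rewrite /= !inE !negb_or !andbT => /and3P[/and3P[ab ac ae] /andP[bc be] ce].
rewrite !eq_set2 (eq_sym e a) (eq_sym c a) (eq_sym c b) (eq_sym e b) (eq_sym b a).
by rewrite (negPf ab) (negPf ac) (negPf ae) (negPf bc) (negPf be) (negPf ce) /= ?andbF.
Qed.

Lemma degree_switch F a b c e G v : switchable F a b c e G ->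
  degree (switch a b c e G) v = degree G v.
Proof.
case/switchableP=> _ _ Uabce [abG _ ceG _] [acG beG].
have [ab_ce _ _ _ [_ ac_be]] := uniq4_set2 Uabce.
have ceG' : [set c; e] \in G :\ [set a; b] by rewrite in_setD1 eq_sym ab_ce.
rewrite /switch degree_setU1; last by rewrite !inE (negPf acG) (negPf ac_be) !andbF.
rewrite degree_setU1; last by rewrite !inE (negPf beG) !andbF.
rewrite (degree_setD1 v abG) (degree_setD1 v ceG').
have [ab ac be ce] : [/\ a != b, a != c, b != e & c != e].
  by move: Uabce; rewrite /= !inE !negb_or => /and4P[/and3P[-> -> _] /andP[_ ->] ->].
by rewrite !in_set2_add // addnA addnACA -addnA.
Qed.

Lemma regular_switch F a b c e G : switchable F a b c e G ->
  switch a b c e G \in regular_graphs n d.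
Proof.
move=> ok; case/switchableP: (ok) => regG _ Uabce _ _.
rewrite inE; apply/andP; split; last first.
  by apply/forallP => v; rewrite (degree_switch v ok) (regular_degree v regG).
apply/forall_inP => f; rewrite in_switch; move: Uabce; rewrite /= !inE !negb_or.
case/and4P=> /and3P[_ ac _] /andP[_ be] _ _.
case/or3P => [/eqP->|/eqP->|/and3P[_ _ fG]]; rewrite ?cards2 ?ac ?be //.
exact: (forall_inP (regular_simple regG)).
Qed.

Lemma switchable_switch F a b c e G : switchable F a b c e G ->
  switchable F a c b e (switch a b c e G).
Proof.
move=> ok; case/switchableP: (ok) => _ FG Uabce [abG abF ceG ceF] [acG beG].
have [_ ab_ac ab_be ce_ac [ce_be _]] := uniq4_set2 Uabce.
have notin_F f : f \notin G -> f \notin F by apply: contra; apply/subsetP.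
apply/andP; split; [apply/and3P|apply/and4P]; split.
- exact: regular_switch ok.
- apply/subsetP => f fF; rewrite in_switch (subsetP FG _ fF) andbT.
  by apply/or3P/Or33/andP; split; [apply: contraNneq ceF => <-| apply: contraNneq abF => <-].
- move: Uabce; rewrite /= !inE !negb_or (eq_sym c b).
  by case/and4P=> /and3P[-> -> ->] /andP[-> ->] ->.
- by rewrite inE in_switch eqxx notin_F.
- by rewrite inE in_switch eqxx orbT notin_F.
- by rewrite in_switch (negPf ab_ac) (negPf ab_be) eqxx andbF.
- by rewrite in_switch (negPf ce_ac) (negPf ce_be) eqxx.
Qed.

Lemma switchK F a b c e G : switchable F a b c e G ->
  switch a c b e (switch a b c e G) = G.
Proof.
move=> ok; case/switchableP: (ok) => _ _ _ [abG _ ceG _] [acG beG].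
apply/setP => f; rewrite !in_switch.
have [->|_] := eqVneq f [set a; b]; first by rewrite abG.
have [->|_] := eqVneq f [set c; e]; first by rewrite ceG.
have [->|_] := eqVneq f [set b; e]; first by rewrite (negPf beG).
by have [->|_] := eqVneq f [set a; c]; first by rewrite (negPf acG).
Qed.

Lemma reindex_switch (R : nmodType) F a b c e (h : edge_set n -> R) :
  \sum_(G | switchable F a b c e G) h G =
  \sum_(G | switchable F a c b e G) h (switch a c b e G).
Proof.
rewrite (reindex_onto (switch a c b e) (switch a b c e)); last first.
  by move=> G; apply: switchK.
apply: eq_bigl => G; apply/andP/idP => [[ok /eqP <-]|ok]; first exact: switchable_switch.
by rewrite switchable_switch // (switchK ok).
Qed.

(** * Counting switchings *)

(* A switch of [G] fixing [F] is determined by the ordered edge [uw] when it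
   deletes [xy], and by the edges [xu], [yw] when it inserts [xy]. *)
Definition deletions F x y G : nat := (\sum_u \sum_w switchable F x y u w G)%N.

Definition insertions F x y G : nat := (\sum_u \sum_w switchable F x u y w G)%N.

Definition free_slots F x y : nat := ((d - degree F x) * (d - degree F y))%N.

Lemma sum_outer_pairs F x y G : G \in regular_graphs n d -> F \subset G ->
  (\sum_u \sum_w (([set x; u] \in G :\: F) && ([set y; w] \in G :\: F))
   = free_slots F x y)%N.
Proof.
move=> regG FG; have simpleG := regular_simple regG.
rewrite /free_slots -{1}(regular_degree x regG) -(regular_degree y regG).
rewrite -!(sum_adjacent_setD _ simpleG FG) big_distrl /=; apply: eq_bigr => u _.
by rewrite big_distrr /=; apply: eq_bigr => w _; rewrite mulnb.
Qed.

Lemma switchable_outer F x u y w G : switchable F x u y w G ->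
  ([set x; u] \in G :\: F) && ([set y; w] \in G :\: F).
Proof. by case/switchableP=> _ _ _ [xuG xuF ywG ywF] _; rewrite !in_setD xuG xuF ywG ywF. Qed.

Lemma insertions_le F x y G : G \in regular_graphs n d -> F \subset G ->
  (insertions F x y G <= free_slots F x y)%N.
Proof.
move=> regG FG; rewrite -(sum_outer_pairs x y regG FG).
apply: leq_sum => u _; apply: leq_sum => w _.
by case: (boolP (switchable F _ _ _ _ _)) => // /switchable_outer ->.
Qed.

Lemma deletions_le F x y G : G \in regular_graphs n d -> (deletions F x y G <= n * d)%N.
Proof.
move=> regG; rewrite -[n in leqRHS]card_ord -sum_nat_const; apply: leq_sum => u _.
rewrite -(sum_adjacent_regular u regG); apply: leq_sum => w _.
by case: (boolP (switchable F _ _ _ _ _)) => // /switchableP[_ _ _ [_ _ -> _] _].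
Qed.

(* The ordered edges [uw] of [G] that cannot be switched with [xy] lie in [F],
   meet [xy], or have [xu] or [yw] in [G]. *)
Definition switch_loss k : nat := (2 * k + 4 * d + 2 * d ^ 2)%N.

Lemma leq_switch_loss k k' : (k <= k')%N -> (switch_loss k <= switch_loss k')%N.
Proof. by move=> kk'; rewrite /switch_loss !leq_add2r leq_pmul2l. Qed.

Lemma sum_switch_obstructions F x y G : simple_graph F -> G \in regular_graphs n d ->
    let g u w : nat := ([set u; w] \in G) in
  (\sum_u \sum_w (([set u; w] \in F)
    + (((u == x) + (u == y) + (w == x) + (w == y)) * g u w)
    + (g x u * g u w + g y w * g u w)) = switch_loss #|F|)%N.
Proof.
move=> simpleF regG g; have gC u w : g u w = g w u by rewrite /g setUC.
have sum_g u : (\sum_w g u w = d)%N by apply: sum_adjacent_regular.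
have sum_from (k : 'I_n -> nat) : (\sum_u \sum_w k u * g u w = (\sum_u k u) * d)%N.
  by under eq_bigr do rewrite -big_distrr sum_g /=; rewrite -big_distrl.
have sum_to (k : 'I_n -> nat) : (\sum_u \sum_w k w * g u w = (\sum_w k w) * d)%N.
  by rewrite exchange_big -sum_from; do 2!apply: eq_bigr => ? _; rewrite gC.
have sum_eq v : (\sum_u (u == v) = 1)%N.
  by rewrite (bigD1 v) //= eqxx big1 // => u /negPf ->.
under eq_bigr => u _ do under eq_bigr => w _ do rewrite !mulnDl.
under eq_bigr => u _ do rewrite !big_split /=; rewrite !big_split /= !sum_from !sum_to.
under eq_bigr do rewrite sum_adjacent //.
rewrite handshake // !sum_eq !sum_g /switch_loss -mulnn; ring.
Qed.

Lemma deletions_ge F x y G : G \in regular_graphs n d -> F \subset G ->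
    [set x; y] \in G :\: F ->
  (n * d <= deletions F x y G + switch_loss #|F|)%N.
Proof.
move=> regG FG xyGF; have simpleG := regular_simple regG.
have xy : x != y by move: xyGF; rewrite inE => /andP[_ /(simple_edge_neq simpleG)].
rewrite -(sum_switch_obstructions x y (simple_subset FG simpleG) regG).
rewrite -[n in leqLHS]card_ord -sum_nat_const -big_split; apply: leq_sum => u _ /=.
rewrite -(sum_adjacent_regular u regG) -big_split; apply: leq_sum => w _ /=.
case: (boolP (_ \in G)) => //= uwG; rewrite !muln1.
rewrite /switchable regG FG xyGF inE uwG !andbT /= !inE.
rewrite (eq_sym x u) (eq_sym x w) (eq_sym y u) (eq_sym y w) (negPf xy).
rewrite (simple_edge_neq simpleG uwG).
by case: ([set u; w] \in F); case: (u == x); case: (u == y); case: (w == x);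
  case: (w == y); case: (_ \in G); case: (_ \in G).
Qed.

End Switching.

Lemma sum_double_count (R : pzSemiRingType) (I J T : finType) (P : I -> J -> pred T) (Q : pred T)
    (t : I -> J -> T -> R) : (forall i j z, P i j z -> Q z) ->
  \sum_i \sum_j \sum_(z | P i j z) t i j z =
  \sum_(z | Q z) \sum_i \sum_j (P i j z)%:R * t i j z.
Proof.
move=> PQ; rewrite [RHS]exchange_big /=; apply: eq_bigr => i _.
rewrite [RHS]exchange_big /=; apply: eq_bigr => j _.
rewrite big_mkcond [RHS]big_mkcond /=; apply: eq_bigr => z _.
by case: (boolP (P i j z)) => [/PQ -> |_]; rewrite ?mul1r ?mul0r ?if_same.
Qed.

Section GraphSums.
Variables (R : realFieldType) (n d : nat).
Implicit Types (a u w x y z : 'I_n) (f : {set 'I_n}) (E F G : edge_set n).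
Implicit Types (h : edge_set n -> R) (k : 'I_n -> 'I_n -> edge_set n -> R).
Local Notation reg := (regular_graphs n d).

Definition graph_sum h F : R := \sum_(G in reg | F \subset G) h G.

Definition graph_count F : R := graph_sum (fun=> 1) F.

Lemma ler_graph_sum h h' F :
    (forall G, G \in reg -> F \subset G -> h G <= h' G) ->
  graph_sum h F <= graph_sum h' F.
Proof. by move=> le_h; apply: ler_sum => G /andP[]; apply: le_h. Qed.

Lemma graph_sumZ c h F : graph_sum (fun G => c * h G) F = c * graph_sum h F.
Proof. by rewrite /graph_sum mulr_sumr. Qed.

Lemma graph_sumD h h' F : graph_sum (fun G => h G + h' G) F = graph_sum h F + graph_sum h' F.
Proof. exact: big_split. Qed.

Lemma graph_sum_sum (I : finType) (K : I -> edge_set n -> R) F :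
  graph_sum (fun G => \sum_i K i G) F = \sum_i graph_sum (K i) F.
Proof. exact: exchange_big. Qed.

Lemma graph_sum_cst c F : graph_sum (fun=> c) F = c * graph_count F.
Proof. by rewrite /graph_count -graph_sumZ mulr1. Qed.

Lemma graph_sum_ge0 h F : (forall G, 0 <= h G) -> 0 <= graph_sum h F.
Proof. by move=> h0; apply: sumr_ge0. Qed.

Lemma graph_count_ge0 F : 0 <= graph_count F.
Proof. exact: graph_sum_ge0. Qed.

Lemma norm_graph_sum h F : `|graph_sum h F| <= graph_sum (fun G => `|h G|) F.
Proof. exact: ler_norm_sum. Qed.

Lemma graph_sum0 h : graph_sum h set0 = \sum_(G in reg) h G.
Proof. by apply: eq_bigl => G; rewrite sub0set andbT. Qed.

Lemma graph_sum_subset E F :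
  graph_sum (fun G => (E \subset G)%:R) F = graph_count (E :|: F).
Proof.
rewrite /graph_count /graph_sum big_mkcondr [RHS]big_mkcondr /=.
apply: eq_bigr => G _; rewrite subUset.
by case: (F \subset G); rewrite ?andbF ?andbT //; case: (E \subset G).
Qed.

Lemma graph_sum_mem f F : graph_sum (fun G => (f \in G)%:R) F = graph_count (f |: F).
Proof. by rewrite -graph_sum_subset; apply: eq_bigr => G _; rewrite sub1set. Qed.

Lemma sum_adjacentR u G : G \in reg -> \sum_w ([set u; w] \in G)%:R = d%:R :> R.
Proof. by move=> regG; rewrite -natr_sum (sum_adjacent_regular u regG). Qed.

Lemma sum_graph_count_edge F a :
  \sum_z graph_count ([set a; z] |: F) = d%:R * graph_count F.
Proof.
under eq_bigr do rewrite -graph_sum_mem.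
rewrite -graph_sum_sum -graph_sum_cst; apply: eq_bigr => G /andP[regG _].
exact: sum_adjacentR.
Qed.

Definition deletion_sum k F x y : R :=
  \sum_u \sum_w \sum_(G | switchable d F x y u w G) k u w G.

Definition insertion_sum k F x y : R :=
  \sum_u \sum_w \sum_(G | switchable d F x u y w G) k u w G.

Lemma deletion_sumE k F x y : deletion_sum k F x y =
  graph_sum (fun G => \sum_u \sum_w (switchable d F x y u w G)%:R * k u w G)
    ([set x; y] |: F).
Proof.
apply: sum_double_count => u w G /switchableP[-> FG _ [xyG _ _ _] _].
by rewrite subUset sub1set xyG FG.
Qed.

Lemma insertion_sumE k F x y : insertion_sum k F x y =
  graph_sum (fun G => \sum_u \sum_w (switchable d F x u y w G)%:R * k u w G) F.
Proof. by apply: sum_double_count => u w G /switchableP[-> ->]. Qed.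

Lemma deletion_sum_graph h F x y : deletion_sum (fun _ _ => h) F x y =
  graph_sum (fun G => (deletions d F x y G)%:R * h G) ([set x; y] |: F).
Proof.
rewrite deletion_sumE; apply: eq_bigr => G _.
rewrite /deletions natr_sum mulr_suml; apply: eq_bigr => u _.
by rewrite natr_sum mulr_suml.
Qed.

Lemma insertion_sum_graph h F x y : insertion_sum (fun _ _ => h) F x y =
  graph_sum (fun G => (insertions d F x y G)%:R * h G) F.
Proof.
rewrite insertion_sumE; apply: eq_bigr => G _.
rewrite /insertions natr_sum mulr_suml; apply: eq_bigr => u _.
by rewrite natr_sum mulr_suml.
Qed.

Lemma deletion_sum_switch k F x y : deletion_sum k F x y =
  insertion_sum (fun u w G => k u w (switch x u y w G)) F x y.
Proof. by apply: eq_bigr => u _; apply: eq_bigr => w _; apply: reindex_switch. Qed.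

Lemma insertion_sum_sym k F x y :
  insertion_sum k F x y = insertion_sum (fun w u => k u w) F y x.
Proof.
rewrite /insertion_sum exchange_big; apply: eq_bigr => w _; apply: eq_bigr => u _.
by apply: eq_bigl => G; apply: switchable_sym.
Qed.

Lemma ler_insertion_sum k k' F x y : (forall u w G, k u w G <= k' u w G) ->
  insertion_sum k F x y <= insertion_sum k' F x y.
Proof. by move=> le_k; do 3!apply: ler_sum => ? _; apply: le_k. Qed.

Lemma insertion_sumZ c k F x y :
  insertion_sum (fun u w G => c * k u w G) F x y = c * insertion_sum k F x y.
Proof.
rewrite /insertion_sum mulr_sumr; apply: eq_bigr => u _.
by rewrite mulr_sumr; apply: eq_bigr => w _; rewrite mulr_sumr.
Qed.

Lemma insertion_sumD k k' F x y :
  insertion_sum (fun u w G => k u w G + k' u w G) F x y =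
  insertion_sum k F x y + insertion_sum k' F x y.
Proof.
rewrite /insertion_sum -big_split; apply: eq_bigr => u _.
by rewrite -big_split; apply: eq_bigr => w _; rewrite -big_split.
Qed.

Lemma insertion_sum_dist k k' F x y : `|insertion_sum k F x y - insertion_sum k' F x y| <=
  insertion_sum (fun u w G => `|k u w G - k' u w G|) F x y.
Proof.
rewrite -sumrB; apply: le_trans (ler_norm_sum _ _ _) _; apply: ler_sum => u _.
rewrite -sumrB; apply: le_trans (ler_norm_sum _ _ _) _; apply: ler_sum => w _.
by rewrite -sumrB ler_norm_sum.
Qed.

Lemma edge_insertion F x y : [set x; y] \notin F ->
  (n * d)%:R * graph_count ([set x; y] |: F) <=
  (free_slots d F x y)%:R * graph_count F
    + (switch_loss d #|F|)%:R * graph_count ([set x; y] |: F).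
Proof.
move=> xyF; rewrite -!graph_sum_cst.
apply: (@le_trans _ _ (deletion_sum (fun _ _ => fun=> 1) F x y
    + graph_sum (fun=> (switch_loss d #|F|)%:R) ([set x; y] |: F))).
  rewrite deletion_sum_graph -graph_sumD; apply: ler_graph_sum => G regG.
  rewrite subUset sub1set mulr1 -natrD ler_nat => /andP[xyG FG].
  by rewrite deletions_ge // inE xyG xyF.
rewrite lerD2r deletion_sum_switch insertion_sum_graph; apply: ler_graph_sum => G regG FG.
by rewrite mulr1 ler_nat insertions_le.
Qed.

Lemma graph_count_eq0 F :
  ~~ [exists G, (G \in reg) && (F \subset G)] -> graph_count F = 0.
Proof.
rewrite negb_exists => /forallP no_graph; apply: big1 => G regG.
by have := no_graph G; rewrite regG.
Qed.

Lemma graph_count_setU1_le F f : f \notin F -> (2 * switch_loss d #|F| <= n * d)%N ->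
  graph_count (f |: F) <= 2 * d%:R / n%:R * graph_count F.
Proof.
move=> fF loss_le; have countF0 := graph_count_ge0 F.
have [/existsP[G /andP[regG]]|/graph_count_eq0 ->] :=
    boolP [exists G, (G \in reg) && (f |: F \subset G)]; last first.
  by rewrite mulr_ge0 // divr_ge0 ?mulr_ge0.
rewrite subUset sub1set => /andP[fG _].
have /cards2P[x [y [xy def_f]]] := forall_inP (regular_simple regG) f fG; subst f.
have d_gt0 : 0 < d%:R :> R.
  by rewrite ltr0n -(regular_degree x regG) (degree_setD1 x fG) set21.
have n_gt0 : 0 < n%:R :> R by rewrite ltr0n (leq_ltn_trans _ (ltn_ord x)).
have := edge_insertion fF; set count1 := graph_count _; set count0 := graph_count F.
have slots_le : (free_slots d F x y)%:R * count0 <= d%:R * d%:R * count0.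
  by rewrite ler_wpM2r // -natrM ler_nat leq_mul ?leq_subr.
have : 2 * ((switch_loss d #|F|)%:R * count1) <= (n * d)%:R * count1.
  by rewrite mulrA ler_wpM2r ?graph_count_ge0 // -natrM ler_nat.
move=> loss_half insertion; rewrite mulrAC ler_pdivlMr // -(ler_pM2l d_gt0).
by move: loss_half insertion slots_le; rewrite natrM; lra.
Qed.

End GraphSums.

(** * Paths and cycles as edge sets *)

Section PathEdges.
Variable n : nat.
Implicit Types (a b h u v w x y : 'I_n) (F G : edge_set n) (p s t : seq 'I_n).

Fixpoint path_edges s : edge_set n :=
  if s is a :: s' then
    if s' is b :: _ then [set a; b] |: path_edges s' else set0
  else set0.

Arguments path_edges : simpl never.

Lemma path_edges0 : path_edges [::] = set0. Proof. by []. Qed.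

Lemma path_edges1 a : path_edges [:: a] = set0. Proof. by []. Qed.

Lemma path_edges_cons2 a b s :
  path_edges [:: a, b & s] = [set a; b] |: path_edges (b :: s).
Proof. by []. Qed.

Definition path_edgesE := (path_edges0, path_edges1, path_edges_cons2).

Lemma path_edges_cat s1 a s2 :
  path_edges (s1 ++ a :: s2) = path_edges (rcons s1 a) :|: path_edges (a :: s2).
Proof.
elim: s1 => [|b [|c s1] IHs] /=; rewrite !path_edgesE.
- by rewrite set0U.
- by rewrite setU0.
- by rewrite -setUA; congr (_ |: _); rewrite -IHs.
Qed.

Lemma path_edges_rcons s a b :
  path_edges (rcons (rcons s a) b) = [set a; b] |: path_edges (rcons s a).
Proof.
by rewrite -[rcons (rcons s a) b]cats1 cat_rcons path_edges_cat !path_edgesE setU0 setUC.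
Qed.

Lemma path_edges_rev s : path_edges (rev s) = path_edges s.
Proof.
elim: s => // a [|b s] IHs //; rewrite path_edges_cons2 -IHs.
by rewrite !rev_cons path_edges_rcons; congr (_ |: _); rewrite setUC.
Qed.

Lemma path_edges_suffix s t : path_edges t \subset path_edges (s ++ t).
Proof. by case: t => [|a t]; rewrite ?sub0set // path_edges_cat subsetUr. Qed.

Lemma path_edges_prefix s t : path_edges s \subset path_edges (s ++ t).
Proof.
by rewrite -(path_edges_rev s) -(path_edges_rev (s ++ t)) rev_cat path_edges_suffix.
Qed.

Lemma card_path_edges s : (#|path_edges s| <= (size s).-1)%N.
Proof.
elim: s => [|a [|b s] IHs]; rewrite path_edgesE ?cards0 //.
by rewrite cardsU1 /= -add1n leq_add // leq_b1.
Qed.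

Lemma path_edges_exit s F : ~~ (path_edges s \subset F) ->
  exists s1 u v s2, [/\ s = s1 ++ [:: u, v & s2],
    path_edges (rcons s1 u) \subset F & [set u; v] \notin F].
Proof.
elim: s => [|a [|b s] IHs]; rewrite path_edgesE ?sub0set // subUset sub1set.
rewrite negb_and; case: (boolP (_ \in F)) => [abF /IHs|abF _]; last first.
  by exists [::], a, b, s; rewrite path_edgesE sub0set.
case=> s1 [u [v [s2 [def_s s1F uvF]]]]; exists (a :: s1), u, v, s2.
rewrite def_s; split=> //; case: s1 def_s s1F => [|c s1] [<-] _ s1F;
  by rewrite path_edgesE subUset sub1set abF.
Qed.

Lemma next_at_edges x y p : uniq (y :: p) ->
  [set [set v; next_at v x y p] | v in y :: p] = [set last y p; x] |: path_edges (y :: p).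
Proof.
elim: p y => [|z p IHp] y.
  move=> _; apply/setP => f; rewrite path_edgesE setU0 inE; apply/imsetP/eqP => [[v]|->].
    by rewrite inE => /eqP -> ->; rewrite /= eqxx.
  by exists y; rewrite ?mem_head //= eqxx.
rewrite cons_uniq => /andP[y_zp Uzp]; rewrite path_edgesE setUCA -(IHp z Uzp).
apply/setP => f; rewrite in_setU1; apply/imsetP/orP => [[v]|].
  rewrite in_cons => /orP[/eqP->|v_zp] ->; first by left; rewrite /= eqxx.
  right; apply/imsetP; exists v => //=; case: eqP v_zp => // -> y_in.
  by rewrite y_in in y_zp.
case=> [/eqP->|/imsetP[v v_zp ->]]; first by exists y; rewrite ?mem_head //= eqxx.
exists v; first by rewrite in_cons v_zp orbT.
by rewrite /=; case: eqP v_zp => // -> y_in; rewrite y_in in y_zp.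
Qed.

Lemma cycle_edges_cons h p : uniq (h :: p) ->
  cycle_edges (h :: p) = [set last h p; h] |: path_edges (h :: p).
Proof. exact: next_at_edges. Qed.

Lemma cycle_edges_rot i s : uniq s -> cycle_edges (rot i s) = cycle_edges s.
Proof.
move=> Us; apply/setP => f; apply/imsetP/imsetP => -[v]; rewrite ?mem_rot => vs ->.
  by exists v; rewrite // (next_rot i Us).
by exists v; rewrite ?mem_rot // (next_rot i Us).
Qed.

Lemma cycle_edges_rev s : uniq s -> cycle_edges (rev s) = cycle_edges s.
Proof.
case: s => // h p; case/lastP: p => // p a Uhpa.
rewrite cycle_edges_cons // last_rcons rev_cons rev_rcons rcons_cons.
rewrite cycle_edges_cons ?last_rcons; last first.
  by rewrite -rcons_cons -rev_rcons -rev_cons rev_uniq.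
by rewrite -rcons_cons -rev_rcons -rev_cons path_edges_rev setUC [[set h; a]]setUC setUC.
Qed.

Section LongCycle.
Variable s : seq 'I_n.
Hypotheses (s_uniq : uniq s) (s_ge3 : (3 <= size s)%N).

Lemma rot_to3 v : v \in s -> exists i a b s', rot i s = [:: v, a, b & s'].
Proof.
case/rot_to=> i s' rot_s; have := s_ge3; rewrite -(size_rot i) rot_s.
by case: s' rot_s => [|a [|b s']] // rot_s _; exists i, a, b, s'.
Qed.

Lemma next_neq v : v \in s -> v != next s v.
Proof.
case/rot_to3=> i [a [b [s' rot_s]]]; rewrite -(next_rot i s_uniq) rot_s /= eqxx.
by move: s_uniq; rewrite -(rot_uniq i) rot_s /= !inE !negb_or => /andP[/andP[]].
Qed.

Lemma next_next_neq v : v \in s -> next s (next s v) != v.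
Proof.
case/rot_to3=> i [a [b [s' rot_s]]]; rewrite -!(next_rot i s_uniq) rot_s /= eqxx.
move: s_uniq; rewrite -(rot_uniq i) rot_s /= !inE !negb_or.
by case/andP=> /and3P[/negPf va vb _] _; rewrite (eq_sym a v) va eqxx eq_sym.
Qed.

Lemma cycle_edge_inj : {in s &, injective (fun v => [set v; next s v])}.
Proof.
move=> v w vs ws /eqP; rewrite eq_set2 => /orP[/andP[/eqP//]|/andP[/eqP-> /eqP next_w]].
by have := next_next_neq ws; rewrite next_w eqxx.
Qed.

Lemma card_cycle_edges : #|cycle_edges s| = size s.
Proof. by rewrite card_in_imset ?(card_uniqP s_uniq) //; apply: cycle_edge_inj. Qed.

Lemma simple_cycle_edges : simple_graph (cycle_edges s).
Proof.
by apply/forall_inP => f /imsetP[v vs ->]; rewrite cards2 next_neq.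
Qed.

Lemma degree_cycle_edges v : degree (cycle_edges s) v = (2 * (v \in s))%N.
Proof.
rewrite degree_sum big_imset /=; last exact: cycle_edge_inj.
under eq_bigr => u us do rewrite in_set2_add ?next_neq //.
have sum_eq w : (\sum_(u in s) (w == u) = (w \in s))%N.
  case: (boolP (w \in s)) => ws; last first.
    by rewrite big1 // => u us; case: eqP ws => // ->; rewrite us.
  by rewrite (bigD1 w) //= eqxx big1 // => u /andP[_]; rewrite eq_sym => /negPf ->.
rewrite big_split /= sum_eq mul2n -addnn; congr addn.
rewrite -(mem_prev s) -sum_eq; apply: eq_bigr => u us.
by rewrite -{1}(next_prev s_uniq v) (inj_eq (can_inj (prev_next s_uniq))).
Qed.

Lemma cycle_open_at a b : [set a; b] \in cycle_edges s ->
  exists p, [/\ uniq (b :: rcons p a), size (b :: rcons p a) = size s &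
    cycle_edges (b :: rcons p a) = cycle_edges s].
Proof.
case/imsetP=> v vs /eqP; rewrite eq_set2.
have [i [w [u [s' rot_s]]]] := rot_to3 vs.
have rot1_s : rot 1 (rot i s) = w :: rcons (u :: s') v by rewrite rot_s rot1_cons.
have <- : w = next s v by rewrite -(next_rot i s_uniq) rot_s /= eqxx.
case/orP=> /andP[/eqP-> /eqP->].
  exists (u :: s'); rewrite -rot1_s !rot_uniq !size_rot; split=> //.
  by rewrite !cycle_edges_rot // rot_uniq.
exists (rev (u :: s')).
have -> : v :: rcons (rev (u :: s')) w = rev (rot 1 (rot i s)).
  by rewrite rot1_s [RHS]rev_cons rev_rcons.
rewrite rev_uniq size_rev !rot_uniq !size_rot; split=> //.
by rewrite cycle_edges_rev ?rot_uniq // !cycle_edges_rot ?rot_uniq.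
Qed.

End LongCycle.

Lemma closing_edge_notin h p : uniq (h :: p) -> (3 <= size (h :: p))%N ->
  [set last h p; h] \notin path_edges (h :: p).
Proof.
move=> Uhp hp3; apply/negP => closing_in.
have cycle_eq_path : cycle_edges (h :: p) = path_edges (h :: p).
  by rewrite cycle_edges_cons //; apply/setUidPr; rewrite sub1set.
by have := card_path_edges (h :: p); rewrite -cycle_eq_path card_cycle_edges // ltnn.
Qed.

(* At each vertex of the smaller cycle both cycles have the same two edges, so
   its vertex set is closed under [next] in the larger one. *)
Lemma cycle_edges_subset_eq s t : uniq s -> uniq t -> (3 <= size s)%N -> (3 <= size t)%N ->
  cycle_edges s \subset cycle_edges t -> cycle_edges s = cycle_edges t.
Proof.
move=> Us Ut s3 t3 s_sub_t.
have sub_st v : v \in s -> v \in t.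
  move=> vs; have := degree_subset v s_sub_t; rewrite !degree_cycle_edges // vs.
  by case: (v \in t).
have next_edge v : v \in s -> [set v; next t v] \in cycle_edges s.
  move=> vs; have vt := sub_st v vs.
  have : [set f in cycle_edges s | v \in f] == [set f in cycle_edges t | v \in f].
    rewrite eqEcard; apply/andP; split.
      by apply/subsetP => f; rewrite !inE => /andP[/(subsetP s_sub_t)-> ->].
    by rewrite [leqLHS]degree_cycle_edges // [leqRHS]degree_cycle_edges // vs vt.
  move/eqP/setP/(_ [set v; next t v]); rewrite !inE eqxx !andbT => ->.
  by apply/imsetP; exists v.
have next_closed v : v \in s -> next t v \in s.
  move=> /next_edge vt_s; have := degree_cycle_edges Us s3 (next t v).
  by rewrite (degree_setD1 _ vt_s) set22; case: (_ \in s).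
have [v vs] : exists v, v \in s by case: (s) s3 => // v s' _; exists v; rewrite mem_head.
apply/eqP; rewrite eqEsubset s_sub_t /=; apply/subsetP => f /imsetP[w wt ->].
apply: next_edge; have v_to_w : fconnect (next t) v w.
  by rewrite (fconnect_cycle (cycle_next Ut) (sub_st v vs)).
rewrite -(iter_findex v_to_w).
by elim: (findex _ _ _) => //= k; apply: next_closed.
Qed.

Definition path_in G s : bool := uniq s && (path_edges s \subset G).

Lemma path_in_cons G h s : path_in G (h :: s) -> path_in G s.
Proof.
case/andP=> /= /andP[_ Us] hsG; rewrite /path_in Us.
exact: subset_trans (path_edges_suffix [:: h] s) hsG.
Qed.

Definition closing_path G F v t : bool :=
  [&& path_in G t, [set head v t; v] \in G, [set head v t; v] \notin F
    & [set head v t; v] \notin path_edges t].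

Lemma cycle_prefix_closing G F h p t t' : uniq (h :: p) -> (3 <= size (h :: p))%N ->
    cycle_edges (h :: p) \subset G -> [set h; last h p] \notin F ->
    h :: p = t ++ t' -> t != [::] ->
  closing_path G F (last h p) t.
Proof.
move=> Uhp hp3; rewrite cycle_edges_cons // subUset sub1set => /andP[closeG pG] closeF.
case: t => // a t [<- def_p] _; have closeP := closing_edge_notin Uhp hp3.
have tp : path_edges (h :: t) \subset path_edges (h :: p).
  by rewrite def_p -cat_cons path_edges_prefix.
rewrite setUC in closeG; rewrite setUC in closeP.
rewrite /closing_path /path_in (subset_trans tp pG) andbT /= closeG closeF.
rewrite (contra (subsetP tp _)) // !andbT; move: Uhp.
by rewrite def_p -cat_cons cat_uniq => /and3P[].
Qed.

Lemma cycle_closing G F s a b : uniq s -> (3 <= size s)%N ->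
    [set a; b] \in cycle_edges s -> [set a; b] \notin F -> cycle_edges s \subset G ->
  exists t, [/\ size t = (size s).-1, head a t = b & closing_path G F a (rcons t a)].
Proof.
move=> Us s3 abs abF sG; have [p [Ubpa size_p edges_p]] := cycle_open_at Us s3 abs.
exists (b :: p); split=> //; first by rewrite -size_p /= size_rcons.
have := @cycle_prefix_closing G F b (rcons p a) (rcons (b :: p) a) [::] Ubpa.
rewrite last_rcons size_p edges_p cats0; apply=> //.
by rewrite setUC.
Qed.

(* Leave [y] backwards from [x] along the cycle: the first edge [uv] outside [F]
   splits it into a path from [u] to [y] in [F] and a path from [v] to [x]. *)
Lemma cycle_exit G F s x y : uniq s -> (3 <= size s)%N ->
    [set x; y] \in cycle_edges s -> [set x; y] \in F ->
    ~~ (cycle_edges s \subset F) -> cycle_edges s \subset G ->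
  exists t t', [/\ (size t + size t' + 2 = size s)%N, path_in F (t ++ [:: x; y]) &
    closing_path G F (head x (t ++ [:: x; y])) (t' ++ [:: y; x])].
Proof.
move=> Us s3 xys xyF sF sG.
have [|p [Up size_p edges_p]] := cycle_open_at (a := y) (b := x) Us s3; first by rewrite setUC.
rewrite -edges_p -size_p in sF sG s3 *.
have {sF} : ~~ (path_edges (x :: rcons p y) \subset F).
  by move: sF; rewrite cycle_edges_cons // last_rcons subUset sub1set setUC xyF.
case/path_edges_exit=> s1 [u [v [s2 [def_p s1F uvF]]]].
have [t def_t] : exists t, rcons s1 u = x :: t.
  by case: (s1) def_p => [|a t] [-> _]; [exists [::]|exists (rcons t u)].
have [t' def_t'] : exists t', v :: s2 = rcons t' y.
  exists (belast v s2); rewrite lastI; congr rcons.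
  by have := congr1 (last x) def_p; rewrite /= last_rcons last_cat.
rewrite -cat_rcons def_t def_t' in def_p; exists (rev t), t'.
have -> : rev t ++ [:: x; y] = rev [:: y, x & t] by rewrite !rev_cons -!cats1 -catA.
have -> : t' ++ [:: y; x] = rcons (v :: s2) x by rewrite def_t' -!cats1 -catA.
rewrite {1}def_p size_rev size_cat size_rcons; split; first by rewrite /= !addnS addn0.
  rewrite /path_in rev_uniq path_edges_rev path_edgesE subUset sub1set setUC xyF -def_t s1F.
  rewrite andbT def_t cons_uniq; move: Up.
  by rewrite def_p cat_uniq => /and3P[-> /hasPn/(_ y) -> //]; rewrite mem_rcons mem_head.
have -> : head x (rev [:: y, x & t]) = last v (s2 ++ x :: t).
  by rewrite rev_cons -def_t rev_rcons last_cat last_rcons.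
have def_rot : v :: s2 ++ x :: t = rot (size (x :: t)) (x :: rcons p y).
  by rewrite def_p rot_size_cat -def_t'.
apply: (@cycle_prefix_closing _ _ _ _ _ t); rewrite ?def_rot ?rot_uniq ?size_rot //.
- by rewrite cycle_edges_rot.
- by rewrite last_cat -def_t last_rcons setUC.
- by rewrite -def_rot cat_rcons.
Qed.

End PathEdges.

Arguments path_edges {n} s : simpl never.

(** * Counting paths that close up *)

Lemma sum_tuple_rcons (R : nmodType) (V : finType) m (F : seq V -> R) :
  \sum_(t : m.+1.-tuple V) F t = \sum_v \sum_(t : m.-tuple V) F (rcons t v).
Proof.
rewrite pair_bigA /= (reindex (fun p : V * m.-tuple V => rcons_tuple p.2 p.1)) //=.
exists (fun t => (last (thead t) (behead t), belast_tuple (thead t) (behead_tuple t))).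
  case=> v t _ /=; have := congr1 val (tuple_eta (rcons_tuple t v)).
  rewrite /= lastI => /rcons_inj[belast_t last_t].
  by congr (_, _); [|apply/val_inj].
by move=> t _; apply/val_inj; case/tupleP: t => w t; rewrite /= theadE -lastI.
Qed.

Lemma sum_tuple0 (R : nmodType) (V : finType) (F : seq V -> R) :
  \sum_(t : 0.-tuple V) F t = F [::].
Proof. by rewrite (bigD1 [tuple]) //= big1 ?addr0 // => t; rewrite tuple0. Qed.

Lemma sum_tuple1 (R : nmodType) (V : finType) (F : seq V -> R) :
  \sum_(t : 1.-tuple V) F t = \sum_v F [:: v].
Proof.
rewrite sum_tuple_rcons; apply: eq_bigr => v _.
exact: (sum_tuple0 (fun t => F (rcons t v))).
Qed.

Lemma sum_tuple2 (R : nmodType) (V : finType) (F : seq V -> R) :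
  \sum_(t : 2.-tuple V) F t = \sum_v \sum_w F [:: w; v].
Proof.
rewrite sum_tuple_rcons; apply: eq_bigr => v _.
exact: (sum_tuple1 (fun t => F (rcons t v))).
Qed.

Lemma eq_ler (R : numDomainType) (x y : R) : x = y -> x <= y.
Proof. by move=> ->. Qed.

Lemma ler_sum_term (R : numDomainType) (I : finType) (F : I -> R) (i : I) :
  (forall j, 0 <= F j) -> F i <= \sum_j F j.
Proof. by move=> F_ge0; rewrite (bigD1 i) //= lerDl sumr_ge0. Qed.

Lemma ler_sum_image (R : numDomainType) (I J : finType) (T : J -> finType)
    (P : pred I) (Q : forall j, pred (T j)) (phi : forall j, T j -> I) :
    (forall i, P i -> exists j t, Q j t && (phi j t == i)) ->
  \sum_i (P i)%:R <= \sum_j \sum_(t : T j) (Q j t)%:R :> R.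
Proof.
move=> witness; pose hit i j t : R := (Q j t && (phi j t == i))%:R.
have hit_ge0 i j t : 0 <= hit i j t by [].
apply: (@le_trans _ _ (\sum_i \sum_j \sum_t hit i j t)).
  apply: ler_sum => i _; case: (boolP (P i)) => [/witness[j [t Qt]]|_]; last first.
    by do 2!apply: sumr_ge0 => ? _.
  apply: le_trans (ler_sum_term j _) => [|j']; last exact: sumr_ge0.
  by apply: le_trans (ler_sum_term t _) => //; rewrite /hit Qt.
rewrite exchange_big; apply: ler_sum => j _; rewrite exchange_big; apply: ler_sum => t _.
rewrite /hit (bigD1 (phi j t)) //= eqxx andbT big1 ?addr0 // => i.
by rewrite eq_sym => /negPf ->; rewrite andbF.
Qed.

Section PathCounting.
Variables (R : realFieldType) (n : nat).
Implicit Types (v x z : 'I_n) (F G : edge_set n) (s t : seq 'I_n).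

Lemma sum_path_in_cons G q s : simple_graph G -> (forall v, degree G v <= q.+1)%N ->
  (2 <= size s)%N -> (\sum_h path_in G (h :: s) <= q * path_in G s)%N.
Proof.
move=> simpleG degG; case: s => // b [|c s] // _.
case: (boolP (path_in G [:: b, c & s])) => [pG|npG]; last first.
  rewrite muln0 big1 // => h _; case: (boolP (path_in _ _)) => // /path_in_cons.
  by rewrite (negPf npG).
have bcG : [set b; c] \in G.
  by case/andP: pG => _; rewrite path_edgesE subUset sub1set => /andP[].
rewrite muln1 -ltnS; apply: leq_trans (degG b); rewrite -(sum_adjacent b simpleG).
rewrite (bigD1 c) //= [leqRHS](bigD1 c) //= bcG.
have -> : path_in G [:: c, b, c & s] = false.
  by apply/negbTE; rewrite /path_in /= !inE eqxx orbT.
rewrite add0n add1n ltnS; apply: leq_sum => h _.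
case: (boolP (path_in _ _)) => // /andP[_].
by rewrite path_edgesE subUset sub1set setUC => /andP[-> _].
Qed.

Lemma sum_path_in_cat G q m s : simple_graph G -> (forall v, degree G v <= q.+1)%N ->
  (2 <= size s)%N ->
  \sum_(t : m.-tuple 'I_n) (path_in G (t ++ s))%:R <= q%:R ^+ m * (path_in G s)%:R :> R.
Proof.
move=> simpleG degG; elim: m s => [|m IHm] s s2.
  by rewrite (sum_tuple0 (fun t => (path_in G (t ++ s))%:R)) expr0 mul1r.
rewrite (sum_tuple_rcons _ (fun t => (path_in G (t ++ s))%:R)).
apply: (@le_trans _ _ (\sum_h q%:R ^+ m * (path_in G (h :: s))%:R)).
  apply: ler_sum => h _; under eq_bigr do rewrite cat_rcons.
  by apply: IHm; rewrite /= ltnW.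
rewrite -mulr_sumr exprSr -mulrA ler_wpM2l ?exprn_ge0 //.
by rewrite -natr_sum -natrM ler_nat sum_path_in_cons.
Qed.

Variable d : nat.
Local Notation graph_sum := (@graph_sum R n d).
Local Notation graph_count := (@graph_count R n d).

Lemma closing_path_count F v t : (2 * switch_loss d (#|F| + size t) <= n * d)%N ->
  graph_sum (fun G => (closing_path G F v t)%:R) F <=
  2 * d%:R / n%:R * graph_sum (fun G => (path_in G t)%:R) F.
Proof.
move=> loss_le; set closing := [set head v t; v].
have [/and3P[Ut closeF closeT]|not_path] :=
    boolP [&& uniq t, closing \notin F & closing \notin path_edges t]; last first.
  rewrite [leLHS]big1 => [|G _].
    by rewrite mulr_ge0 ?graph_sum_ge0 // divr_ge0 ?mulr_ge0.
  case: (boolP (closing_path _ _ _ _)) not_path => // /and4P[/andP[-> _] _].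
  by rewrite /closing => -> ->.
have -> : graph_sum (fun G => (closing_path G F v t)%:R) F =
    graph_count ((closing |: path_edges t) :|: F).
  rewrite -graph_sum_subset; apply: eq_bigr => G _.
  by rewrite /closing_path /path_in Ut closeF closeT !andbT subUset sub1set andbC.
have -> : graph_sum (fun G => (path_in G t)%:R) F = graph_count (path_edges t :|: F).
  by rewrite -graph_sum_subset; apply: eq_bigr => G _; rewrite /path_in Ut.
rewrite -setUA; apply: graph_count_setU1_le; first by rewrite in_setU negb_or closeT.
apply: leq_trans loss_le; rewrite leq_pmul2l // leq_switch_loss //.
apply: leq_trans (leq_card_setU _ _).1 _; rewrite addnC leq_add2l.
exact: leq_trans (card_path_edges t) (leq_pred _).
Qed.

Lemma sum_closing_path_cat F v m s : (2 <= size s)%N ->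
    (2 * switch_loss d (#|F| + (m + size s)) <= n * d)%N ->
  \sum_(t : m.-tuple 'I_n) graph_sum (fun G => (closing_path G F v (t ++ s))%:R) F <=
  2 * d%:R / n%:R * d.-1%:R ^+ m * graph_count (path_edges s :|: F).
Proof.
move=> s2 loss_le; have c_ge0 : 0 <= 2 * d%:R / n%:R :> R by rewrite divr_ge0 ?mulr_ge0.
apply: (@le_trans _ _ (2 * d%:R / n%:R *
    \sum_(t : m.-tuple 'I_n) graph_sum (fun G => (path_in G (t ++ s))%:R) F)).
  rewrite mulr_sumr; apply: ler_sum => t _; apply: closing_path_count.
  by rewrite size_cat size_tuple.
rewrite -[leRHS]mulrA ler_wpM2l // -graph_sum_sum -graph_sum_subset -graph_sumZ.
apply: ler_graph_sum => G regG _.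
have degG v' : (degree G v' <= d.-1.+1)%N by rewrite (regular_degree v' regG) leqSpred.
apply: le_trans (sum_path_in_cat m (regular_simple regG) degG s2) _.
by rewrite ler_wpM2l ?exprn_ge0 // ler_nat; case: (boolP (path_in G s)) => // /andP[_ ->].
Qed.

Lemma sum_closing_path_rcons F v x m :
    (2 * switch_loss d (#|F| + m.+2) <= n * d)%N ->
  \sum_(t : m.+1.-tuple 'I_n) graph_sum (fun G => (closing_path G F v (rcons t x))%:R) F <=
  2 * d%:R / n%:R * d.-1%:R ^+ m * (d%:R * graph_count F).
Proof.
move=> loss_le; rewrite -(sum_graph_count_edge R d F x) mulr_sumr.
rewrite (sum_tuple_rcons _
  (fun t => graph_sum (fun G => (closing_path G F v (rcons t x))%:R) F)).
apply: ler_sum => z _; have -> : [set [set x; z]] = path_edges [:: z; x].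
  by rewrite !path_edgesE setU0 setUC.
under eq_bigr do rewrite -cats1 cat_rcons.
by apply: sum_closing_path_cat; rewrite // addn2.
Qed.

End PathCounting.

(** * Counting short cycles through an edge *)

Section GeometricSums.
Variables (R : realDomainType) (q : R).

Definition geometric_sum k : R := \sum_(m < k) q ^+ m.

Definition nested_geometric_sum k : R := \sum_(i < k) geometric_sum (k - i).

Lemma geometric_sum_ge0 k : 0 <= q -> 0 <= geometric_sum k.
Proof. by move=> q_ge0; apply: sumr_ge0 => m _; rewrite exprn_ge0. Qed.

Lemma nested_geometric_sum_ge0 k : 0 <= q -> 0 <= nested_geometric_sum k.
Proof. by move=> q_ge0; apply: sumr_ge0 => i _; apply: geometric_sum_ge0. Qed.

Hypothesis q_ge2 : 2 <= q.

Let exprS_ge k : 2 * q ^+ k <= q ^+ k.+1.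
Proof. by rewrite exprS ler_wpM2r // exprn_ge0 // (le_trans _ q_ge2). Qed.

Lemma geometric_sum_le k : q * geometric_sum k <= 2 * q ^+ k.
Proof.
elim: k => [|k IHk]; first by rewrite /geometric_sum big_ord0 mulr0 mulr_ge0.
rewrite /geometric_sum big_ord_recr /= mulrDr -exprS.
by have := exprS_ge k; move: IHk; rewrite /geometric_sum; lra.
Qed.

Lemma nested_geometric_sum_le k : q * nested_geometric_sum k <= 4 * q ^+ k.
Proof.
elim: k => [|k IHk]; first by rewrite /nested_geometric_sum big_ord0 mulr0 mulr_ge0.
rewrite /nested_geometric_sum big_ord_recl /= subn0 mulrDr.
have {}IHk : q * (\sum_(i < k) geometric_sum (k.+1 - bump 0 i)) <= 4 * q ^+ k by [].
by have := geometric_sum_le k.+1; have := exprS_ge k; lra.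
Qed.

End GeometricSums.

Definition short_cycles n r (C : {set edge_set n}) : Prop :=
  forall E, E \in C -> is_cycle E /\ (cycle_length E <= r)%N.

Definition on_cycle n (C : {set edge_set n}) (G : edge_set n) (f : {set 'I_n}) : bool :=
  [exists E in C, (f \in E) && (E \subset G)].

Section ShortCycles.
Variables (R : realFieldType) (n d r : nat) (C : {set edge_set n}).
Hypothesis C_short : short_cycles r C.
Variable F : edge_set n.
Hypothesis loss_le : (2 * switch_loss d (#|F| + r) <= n * d)%N.
Implicit Types (a b v x y : 'I_n) (G E : edge_set n).
Local Notation graph_sum := (@graph_sum R n d).
Local Notation graph_count := (@graph_count R n d).

Lemma on_cycle_closing G a b : [set a; b] \notin F -> on_cycle C G [set a; b] ->
  exists m : 'I_r.-1, exists t : m.+1.-tuple 'I_n,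
    closing_path G F a (rcons t a) && (head a t == b).
Proof.
move=> abF /existsP[E /and3P[EC abE EG]].
have [[s [Us s3 def_E]] len_E] := C_short EC; rewrite def_E in abE EG len_E.
rewrite /cycle_length card_cycle_edges // in len_E.
have [t [size_t head_t closing_t]] := cycle_closing Us s3 abE abF EG.
have m_lt : ((size t).-1 < r.-1)%N by rewrite size_t; lia.
have size_t' : size t == (size t).-1.+1 by rewrite size_t; lia.
exists (Ordinal m_lt), (Tuple size_t').
by rewrite closing_t head_t eqxx.
Qed.

Lemma sum_on_cycle_notin a :
  graph_sum (fun G => \sum_b (([set a; b] \notin F) && on_cycle C G [set a; b])%:R) F <=
  2 * d%:R ^+ 2 / n%:R * geometric_sum d.-1%:R r.-1 * graph_count F.
Proof.
apply: (@le_trans _ _ (graph_sum (fun G => \sum_(m < r.-1) \sum_(t : m.+1.-tuple 'I_n)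
    (closing_path G F a (rcons t a))%:R) F)).
  apply: ler_graph_sum => G _ _; apply: ler_sum_image => b /andP[abF ab_cycle].
  exact: on_cycle_closing.
rewrite graph_sum_sum [X in _ <= X * _]mulr_sumr mulr_suml; apply: ler_sum => m _.
rewrite graph_sum_sum.
have m_r : (m.+2 <= r)%N by case: m => /= m; lia.
apply: le_trans (sum_closing_path_rcons R a a _) _.
  by apply: leq_trans loss_le; rewrite leq_pmul2l // leq_switch_loss // leq_add2l.
by apply: eq_ler; ring.
Qed.

Lemma on_cycle_exit G x y : [set x; y] \in F -> (forall E, E \in C -> ~~ (E \subset F)) ->
    on_cycle C G [set x; y] ->
  exists i : 'I_r.-1, exists m : 'I_(r.-1 - i),
  exists t : i.-tuple 'I_n, exists t' : m.-tuple 'I_n,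
    path_in F (t ++ [:: x; y]) &&
    closing_path G F (head x (t ++ [:: x; y])) (t' ++ [:: y; x]).
Proof.
move=> xyF not_in_F /existsP[E /and3P[EC xyE EG]]; have := not_in_F E EC.
have [[s [Us s3 def_E]] len_E] := C_short EC; rewrite def_E in xyE EG len_E *.
rewrite /cycle_length card_cycle_edges // in len_E => sF.
have [t [t' [size_tt' path_t closing_t']]] := cycle_exit Us s3 xyE xyF sF EG.
have i_lt : (size t < r.-1)%N by clear -size_tt' len_E; lia.
have m_lt : (size t' < r.-1 - size t)%N by clear -size_tt' len_E; lia.
exists (Ordinal i_lt), (Ordinal m_lt), (in_tuple t), (in_tuple t').
by rewrite path_t.
Qed.

(* As [F] has maximum degree 2, the part of the cycle between [x] and its first
   edge outside [F] is determined by its length. *)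
Lemma sum_on_cycle_mem x y : simple_graph F -> (forall v, degree F v <= 2)%N ->
    [set x; y] \in F -> (forall E, E \in C -> ~~ (E \subset F)) ->
  graph_sum (fun G => (on_cycle C G [set x; y])%:R) F <=
  2 * d%:R / n%:R * nested_geometric_sum d.-1%:R r.-1 * graph_count F.
Proof.
move=> simpleF degF xyF not_in_F.
pose exits (i m : nat) (t : seq 'I_n) G : R := (path_in F (t ++ [:: x; y]))%:R *
  \sum_(t' : m.-tuple 'I_n)
    (closing_path G F (head x (t ++ [:: x; y])) (t' ++ [:: y; x]))%:R.
have exits_ge0 i m t G : 0 <= exits i m t G by rewrite mulr_ge0 // sumr_ge0.
apply: (@le_trans _ _ (graph_sum (fun G =>
    \sum_(i < r.-1) \sum_(m < r.-1 - i) \sum_(t : i.-tuple 'I_n) exits i m t G) F)).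
  apply: ler_graph_sum => G _ _; case: (boolP (on_cycle _ _ _)) => [|_]; last first.
    by do 3!apply: sumr_ge0 => ? _.
  case/(on_cycle_exit xyF not_in_F)=> i [m [t [t' /andP[path_t closing_t']]]].
  apply: le_trans (ler_sum_term i _) => [|?]; last by do 2!apply: sumr_ge0 => ? _.
  apply: le_trans (ler_sum_term m _) => [|?]; last by apply: sumr_ge0.
  apply: le_trans (ler_sum_term t _) => //; rewrite /exits path_t mul1r.
  by apply: le_trans (ler_sum_term t' _) => //; rewrite closing_t'.
rewrite graph_sum_sum [X in _ <= X * _]mulr_sumr mulr_suml; apply: ler_sum => i _.
rewrite graph_sum_sum [X in _ <= X * _]mulr_sumr mulr_suml; apply: ler_sum => m _.
rewrite graph_sum_sum; set bound := (X in _ <= X).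
have bound_ge0 : 0 <= bound.
  by rewrite !mulr_ge0 ?exprn_ge0 ?graph_count_ge0 ?invr_ge0.
apply: (@le_trans _ _
    (\sum_(t : i.-tuple 'I_n) bound * (path_in F (t ++ [:: x; y]))%:R)).
  apply: ler_sum => t _; rewrite graph_sumZ mulrC ler_wpM2r // graph_sum_sum.
  apply: le_trans (sum_closing_path_cat R _ _ _) _ => //.
    apply: leq_trans loss_le; rewrite leq_pmul2l // leq_switch_loss // leq_add2l.
    by case: m {bound bound_ge0} => /= m; lia.
  have -> : path_edges [:: y; x] :|: F = F; last exact: lexx.
  by apply/setUidPr; rewrite !path_edgesE setU0 sub1set setUC.
rewrite -mulr_sumr -[leRHS]mulr1 ler_wpM2l //.
apply: le_trans (sum_path_in_cat R i simpleF degF _) _ => //.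
by rewrite expr1n mul1r lern1 leq_b1.
Qed.

End ShortCycles.

(** * The effect of inserting one edge *)

Definition determined_by (R : Type) n (C : {set edge_set n}) (h : edge_set n -> R) : Prop :=
  forall G G' : edge_set n, (forall E, E \in C -> (E \subset G) = (E \subset G')) -> h G = h G'.

Section SwitchingErrors.
Variables (R : realFieldType) (n d : nat).
Variables (F : edge_set n) (x y : 'I_n).
Hypothesis xy_notin : [set x; y] \notin F.
Implicit Types (u w : 'I_n) (G : edge_set n).
Local Notation reg := (regular_graphs n d).
Local Notation graph_sum := (@graph_sum R n d).
Local Notation graph_count := (@graph_count R n d).
Local Notation F0 := ([set x; y] |: F).

(* Edges [xu] and [yw] outside [F] fail to be switchable only if [xy] is already
   an edge, or [u = w], or [uw] is an edge; in the last two cases [yw] closes up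
   a path starting with [xu]. *)
Lemma free_slots_le G : x != y -> G \in reg -> F \subset G ->
  (free_slots d F x y <= insertions d F x y G + d ^ 2 * ([set x; y] \in G)
    + \sum_u closing_path G F y [:: u; x]
    + \sum_u \sum_w closing_path G F y [:: w; u; x])%N.
Proof.
move=> xy regG FG; have simpleG := regular_simple regG.
rewrite -(sum_outer_pairs x y regG FG).
have -> : (d ^ 2 * ([set x; y] \in G) =
    \sum_u \sum_w ([set x; u] \in G) * ([set y; w] \in G) * ([set x; y] \in G))%N.
  under eq_bigr do rewrite -big_distrl -big_distrr /=.
  rewrite -big_distrl -big_distrl /=.
  by rewrite !(sum_adjacent_regular _ regG) mulnn.
have -> : (\sum_u closing_path G F y [:: u; x] =
    \sum_u \sum_w (u == w) * closing_path G F y [:: u; x])%N.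
  apply: eq_bigr => u _; rewrite -big_distrl /= (bigD1 u) //= eqxx big1 ?mul1n // => w.
  by rewrite eq_sym => /negPf ->.
rewrite -!big_split; apply: leq_sum => u _; rewrite -!big_split; apply: leq_sum => w _ /=.
case: (boolP (_ && _)) => //; rewrite !in_setD.
case/andP=> /andP[xuF xuG] /andP[ywF ywG]; rewrite xuG ywG.
have xu := simple_edge_neq simpleG xuG; have yw := simple_edge_neq simpleG ywG.
have [xyG|xyG] := boolP ([set x; y] \in G); first by rewrite !muln1 addn1 !addSn.
have xw : x != w by apply: contraNneq xyG => ->; rewrite setUC.
have uy : u != y by apply: contraNneq xyG => <-.
have [uw|uw] := eqVneq u w.
  rewrite /closing_path /path_in /= -uw in ywG ywF *.
  rewrite !path_edgesE setU0 sub1set !inE eq_sym xu setUC xuG.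
  rewrite [[set u; y]]setUC ywG ywF /= eq_set2 [y == x]eq_sym (negPf xy).
  by rewrite [y == u]eq_sym (negPf uy) /= addnAC !muln1 addn1.
have [uwG|uwG] := boolP ([set u; w] \in G); last first.
  rewrite /switchable regG FG !in_setD xuF xuG ywF ywG xyG uwG /= !inE !negb_or.
  by rewrite xu xy xw uy uw yw.
rewrite /closing_path /path_in /= !path_edgesE setU0 subUset !sub1set !inE.
rewrite [[set w; u]]setUC [[set u; x]]setUC [[set w; y]]setUC uwG xuG ywG ywF !eq_set2.
rewrite [w == u]eq_sym [w == x]eq_sym [u == x]eq_sym [y == x]eq_sym [y == u]eq_sym.
by rewrite (negPf uw) (negPf xw) (negPf xu) (negPf xy) (negPf uy) !andbF /= addn1.
Qed.

Lemma deletion_sum_error h : (forall G, `|h G| <= 1) ->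
  `|(n * d)%:R * graph_sum h F0 - deletion_sum d (fun _ _ => h) F x y| <=
  (switch_loss d #|F|)%:R * graph_count F0.
Proof.
move=> h_le1; rewrite deletion_sum_graph -graph_sumZ -graph_sum_cst -sumrB.
apply: le_trans (ler_norm_sum _ _ _) _; apply: ler_sum => G /andP[regG].
rewrite subUset sub1set => /andP[xyG FG].
rewrite -mulrBl normrM -[leRHS]mulr1 ler_pM //.
have xyGF : [set x; y] \in G :\: F by rewrite inE xyG xy_notin.
rewrite ger0_norm ?subr_ge0 ?ler_nat ?deletions_le // lerBlDl -natrD ler_nat.
exact: deletions_ge.
Qed.

Lemma insertion_sum_error h : x != y -> (2 * switch_loss d (#|F| + 3) <= n * d)%N ->
    (forall G, `|h G| <= 1) ->
  `|(free_slots d F x y)%:R * graph_sum h F - insertion_sum d (fun _ _ => h) F x y| <=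
  4 * d%:R ^+ 3 / n%:R * graph_count F.
Proof.
move=> xy loss_le h_le1; rewrite insertion_sum_graph -graph_sumZ -sumrB.
pose closings m G : R :=
  \sum_(t : m.+1.-tuple 'I_n) (closing_path G F y (rcons t x))%:R.
apply: (@le_trans _ _ (graph_sum (fun G =>
    d%:R ^+ 2 * ([set x; y] \in G)%:R + closings 0 G + closings 1 G) F)).
  apply: le_trans (ler_norm_sum _ _ _) _; apply: ler_sum => G /andP[regG FG].
  rewrite -mulrBl normrM -[leRHS]mulr1 ler_pM // ger0_norm ?subr_ge0 ?ler_nat ?insertions_le //.
  rewrite /closings (sum_tuple1 (fun t => (closing_path G F y (rcons t x))%:R)).
  rewrite (sum_tuple2 (fun t => (closing_path G F y (rcons t x))%:R)) lerBlDl.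
  under [X in _ + (_ + X)]eq_bigr do rewrite -natr_sum.
  by rewrite -natrX -natrM -!natr_sum -!natrD ler_nat !addnA free_slots_le.
have loss_le' k : (k <= 3)%N -> (2 * switch_loss d (#|F| + k) <= n * d)%N.
  by move=> k3; apply: leq_trans loss_le; rewrite leq_pmul2l // leq_switch_loss ?leq_add2l.
have xyG_le : graph_count F0 <= 2 * d%:R / n%:R * graph_count F.
  by apply: graph_count_setU1_le; rewrite // -[#|F|]addn0 loss_le'.
have closings0_le := sum_closing_path_rcons R y x (loss_le' 2 isT).
have closings1_le := sum_closing_path_rcons R y x (loss_le' 3 isT).
rewrite !graph_sumD graph_sumZ graph_sum_mem !graph_sum_sum.
apply: le_trans (lerD (lerD (ler_wpM2l _ xyG_le) closings0_le) closings1_le) _.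
  by rewrite exprn_ge0.
have [->|d_gt0] := posnP d; first by rewrite !(mul0r, mulr0, expr0n) /= !addr0.
by rewrite -subn1 natrB //; apply: eq_ler; ring.
Qed.

End SwitchingErrors.

(* The relative error, in units of [2 d / n], of inserting one more edge next to
   [k] inserted ones, when the cycles have length at most [r]. *)
Definition switching_error (R : realFieldType) d r k : R :=
  (switch_loss d k)%:R + 2 * d%:R ^+ 2 + 4 * d%:R ^+ 2 *
    (nested_geometric_sum d.-1%:R r.-1 + 2 * geometric_sum d.-1%:R r.-1).

Lemma switching_error_ge0 (R : realFieldType) d r k : 0 <= switching_error R d r k.
Proof.
rewrite /switching_error !addr_ge0 ?mulr_ge0 ?addr_ge0 ?exprn_ge0 //.
  exact: nested_geometric_sum_ge0.
by rewrite mulr_ge0 // geometric_sum_ge0.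
Qed.

Section SwitchingStep.
Variables (R : realFieldType) (n d r : nat) (C : {set edge_set n}).
Hypothesis C_short : short_cycles r C.
Hypothesis r_ge2 : (2 <= r)%N.
Variables (F : edge_set n) (x y : 'I_n) (h : edge_set n -> R).
Local Notation F0 := ([set x; y] |: F).
Hypothesis xy_notin : [set x; y] \notin F.
Hypothesis F0_simple : simple_graph F0.
Hypothesis F0_degree : forall v, (degree F0 v <= 2)%N.
Hypothesis F0_no_cycle : forall E, E \in C -> ~~ (E \subset F0).
Hypothesis loss_le : (2 * switch_loss d (#|F|.+1 + r) <= n * d)%N.
Hypotheses (h_det : determined_by C h) (h_le1 : forall G, `|h G| <= 1).
Implicit Types (a b u w : 'I_n) (G E : edge_set n).
Local Notation graph_sum := (@graph_sum R n d).
Local Notation graph_count := (@graph_count R n d).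
Local Notation on_cycleR G u v := ((on_cycle C G [set u; v])%:R : R).

(* A cycle of [C] appears or disappears only if it uses one of the four edges. *)
Lemma switch_change u w G (G' := switch x u y w G) :
  `|h G' - h G| <=
  2 * (on_cycleR G' x y + on_cycleR G' u w + on_cycleR G x u + on_cycleR G y w).
Proof.
have [/forall_inP same|] := boolP [forall E in C, (E \subset G') == (E \subset G)].
  rewrite (@h_det G' G) ?subrr ?normr0 ?mulr_ge0 ?addr_ge0 // => E EC.
  exact/eqP/same.
rewrite negb_forall_in => /existsP[E /andP[EC differ]].
apply: (@le_trans _ _ (2 * 1)).
  by apply: le_trans (ler_normB _ _) _; rewrite mulr1 -[2]/(1 + 1) lerD.
rewrite ler_pM2l // -!natrD ler1n.
have used G1 f : f \in E -> E \subset G1 -> on_cycle C G1 f.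
  by move=> fE EG1; apply/existsP; exists E; rewrite EC fE.
case: (boolP (E \subset G')) differ => [EG'|/subsetPn[f fE]].
  case: (boolP (E \subset G)) => // /subsetPn[f fE fG] _; have := subsetP EG' f fE.
  rewrite in_switch (negPf fG) !andbF orbF => /orP[] /eqP def_f; rewrite def_f in fE.
    by rewrite (used _ _ fE EG').
  by rewrite (used _ _ fE EG') addn1 !addSn.
case: (boolP (E \subset G)) => // EG; rewrite in_switch !negb_or !negb_and !negbK.
rewrite (subsetP EG f fE) orbF => /and3P[_ _ /orP[] /eqP def_f] _; rewrite def_f in fE.
  by rewrite (used _ _ fE EG) addn1.
by rewrite (used _ _ fE EG) addn1 addSn.
Qed.

Let n_neq0 : n%:R != 0 :> R.
Proof. by rewrite pnatr_eq0 -lt0n (leq_ltn_trans _ (ltn_ord x)). Qed.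

Let card_F0 : #|F0| = #|F|.+1.
Proof. by rewrite cardsU1 xy_notin. Qed.

Let loss_le_F0 : (2 * switch_loss d (#|F0| + r) <= n * d)%N.
Proof. by rewrite card_F0. Qed.

Let loss_le_F : (2 * switch_loss d (#|F| + r) <= n * d)%N.
Proof. by apply: leq_trans loss_le; rewrite leq_pmul2l // leq_switch_loss ?leq_add2r. Qed.

Lemma deletion_sum_on_cycle_fixed :
  deletion_sum d (fun _ _ G => on_cycleR G x y) F x y <=
  2 * d%:R ^+ 2 * nested_geometric_sum d.-1%:R r.-1 * graph_count F0.
Proof.
rewrite (deletion_sum_graph d (fun G => on_cycleR G x y)).
apply: (@le_trans _ _ ((n * d)%:R * graph_sum (fun G => on_cycleR G x y) F0)).
  rewrite -graph_sumZ; apply: ler_graph_sum => G regG _.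
  by rewrite ler_wpM2r // ler_nat deletions_le.
have := sum_on_cycle_mem R C_short loss_le_F0 F0_simple F0_degree (setU11 _ _) F0_no_cycle.
move=> /(ler_wpM2l (ler0n R (n * d))) /le_trans; apply.
by rewrite natrM; apply: eq_ler; field.
Qed.

Lemma deletion_sum_on_cycle_free :
  deletion_sum d (fun u w G => on_cycleR G u w) F x y <=
  2 * d%:R ^+ 2 * geometric_sum d.-1%:R r.-1 * graph_count F0.
Proof.
rewrite deletion_sumE.
apply: (@le_trans _ _ (\sum_u graph_sum (fun G =>
    \sum_w (([set u; w] \notin F0) && on_cycle C G [set u; w])%:R) F0)).
  rewrite -graph_sum_sum; apply: ler_graph_sum => G _ _.
  apply: ler_sum => u _; apply: ler_sum => w _; rewrite -natrM mulnb ler_nat.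
  case: (boolP (switchable _ _ _ _ _ _ _)) => // /switchableP[_ _ Uxyuw [_ _ _ uwF] _].
  have [xy_uw _ _ _ _] := uniq4_set2 Uxyuw.
  by rewrite in_setU1 negb_or uwF eq_sym xy_uw.
apply: le_trans (ler_sum _ (fun u _ => sum_on_cycle_notin R C_short loss_le_F0 u)) _.
by rewrite sumr_const card_ord -[leLHS]mulr_natl; apply: eq_ler; field.
Qed.

Lemma insertion_sum_on_cycle a b :
  insertion_sum d (fun u _ G => on_cycleR G a u) F a b <=
  2 * d%:R ^+ 3 / n%:R * geometric_sum d.-1%:R r.-1 * graph_count F.
Proof.
rewrite insertion_sumE; apply: (@le_trans _ _ (graph_sum (fun G => d%:R *
    \sum_u (([set a; u] \notin F) && on_cycle C G [set a; u])%:R) F)).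
  apply: ler_graph_sum => G regG _; rewrite mulr_sumr; apply: ler_sum => u _.
  rewrite -(sum_adjacentR R b regG) mulr_suml; apply: ler_sum => w _.
  rewrite -!natrM !mulnb ler_nat.
  by case: (boolP (switchable _ _ _ _ _ _ _)) => // /switchableP[_ _ _ [_ -> -> _] _].
rewrite graph_sumZ.
apply: le_trans (ler_wpM2l _ (sum_on_cycle_notin R C_short loss_le_F a)) _ => //.
by apply: eq_ler; field.
Qed.

Lemma deletion_insertion_dist :
  `|deletion_sum d (fun _ _ => h) F x y - insertion_sum d (fun _ _ => h) F x y| <=
  2 * (2 * d%:R ^+ 2 * (nested_geometric_sum d.-1%:R r.-1 + geometric_sum d.-1%:R r.-1)
      * graph_count F0
    + 4 * d%:R ^+ 3 / n%:R * geometric_sum d.-1%:R r.-1 * graph_count F).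
Proof.
rewrite deletion_sum_switch; apply: le_trans (insertion_sum_dist _ _ _ _ _ _) _.
pose change u w G := 2 * (on_cycleR (switch x u y w G) x y
  + on_cycleR (switch x u y w G) u w + on_cycleR G x u + on_cycleR G y w).
apply: (@le_trans _ _ (insertion_sum d change F x y)).
  by apply: ler_insertion_sum => u w G; apply: switch_change.
rewrite insertion_sumZ !insertion_sumD ler_wpM2l //.
have := deletion_sum_on_cycle_fixed; have := deletion_sum_on_cycle_free.
have := insertion_sum_on_cycle x y; have := insertion_sum_on_cycle y x.
rewrite !deletion_sum_switch [insertion_sum _ _ F y x]insertion_sum_sym.
lra.
Qed.

Lemma edge_insertion_error :
  `|(n * d)%:R * graph_sum h F0 - (free_slots d F x y)%:R * graph_sum h F| <=
  2 * d%:R / n%:R * switching_error R d r #|F| * graph_count F.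
Proof.
have xy : x != y by apply: simple_edge_neq F0_simple (setU11 _ _).
have loss_le' k : (k <= #|F|.+1 + r)%N -> (2 * switch_loss d k <= n * d)%N.
  by move=> k_le; apply: leq_trans loss_le; rewrite leq_pmul2l // leq_switch_loss.
have deletion_error := deletion_sum_error d xy_notin h_le1.
have insertion_error : `|(free_slots d F x y)%:R * graph_sum h F
    - insertion_sum d (fun _ _ => h) F x y| <= 4 * d%:R ^+ 3 / n%:R * graph_count F.
  by apply: insertion_sum_error => //; apply: loss_le'; rewrite addSnnS leq_add2l ltnS.
have count_le : graph_count F0 <= 2 * d%:R / n%:R * graph_count F.
  by apply: graph_count_setU1_le => //; apply: loss_le'; rewrite addSnnS leq_addr.
have := deletion_insertion_dist; rewrite /switching_error.
set nested := nested_geometric_sum _ _; set geom := geometric_sum _ _ => change_le.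
set lhs := _ - _; have -> : lhs =
    ((n * d)%:R * graph_sum h F0 - deletion_sum d (fun _ _ => h) F x y)
    + (deletion_sum d (fun _ _ => h) F x y - insertion_sum d (fun _ _ => h) F x y)
    - ((free_slots d F x y)%:R * graph_sum h F - insertion_sum d (fun _ _ => h) F x y).
  by rewrite /lhs; ring.
apply: le_trans (ler_normB _ _) _; apply: le_trans (lerD (ler_normD _ _) insertion_error) _.
apply: le_trans (lerD (lerD deletion_error change_le) (lexx _)) _.
have coef_ge0 : 0 <= (switch_loss d #|F|)%:R + 4 * d%:R ^+ 2 * (nested + geom).
  rewrite addr_ge0 // !mulr_ge0 ?exprn_ge0 // addr_ge0 ?geometric_sum_ge0 //.
  exact: nested_geometric_sum_ge0.
have := ler_wpM2l coef_ge0 count_le; lra.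
Qed.

End SwitchingStep.

(* For [q = d - 1 >= 2], the bounds [d <= 3 q / 2] and [r <= 2 ^ (r - 1)] express
   every term through [q ^ r]. *)
Lemma switching_error_le (R : realFieldType) d r k :
  (3 <= d)%N -> (3 <= r)%N -> (k <= r)%N -> switching_error R d r k <= 100 * d.-1%:R ^+ r.
Proof.
case: d => // d d_ge2; case: r => // r r_ge2 kr; rewrite /switching_error succnK.
set q : R := d%:R; set nested := nested_geometric_sum q r; set geom := geometric_sum q r.
have q_ge2 : 2 <= q by rewrite (ler_nat R 2).
have nested_le : q * nested <= 4 * q ^+ r := nested_geometric_sum_le q_ge2 r.
have geom_le : q * geom <= 2 * q ^+ r := geometric_sum_le q_ge2 r.
have q2_le : q ^+ 2 <= q ^+ r by rewrite ler_weXn2l //; lra.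
have k_le : k%:R <= q ^+ r.
  apply: (@le_trans _ _ (2 ^+ r)); last by rewrite lerXn2r ?nnegrE //; lra.
  by rewrite -natrX ler_nat; apply: leq_trans kr _; apply: ltn_expl.
have d2_le : d.+1%:R ^+ 2 <= 9 / 4 * q ^+ 2 :> R.
  rewrite -natr1 [leRHS](_ : _ = (3 / 2 * q) ^+ 2); last by field.
  by rewrite lerXn2r ?nnegrE; lra.
have sums_le : d.+1%:R ^+ 2 * (nested + 2 * geom) <= 18 * (q * q ^+ r).
  apply: (@le_trans _ _ (9 / 4 * (q * (q * nested + 2 * (q * geom))))).
    rewrite [leRHS](_ : _ = 9 / 4 * q ^+ 2 * (nested + 2 * geom)); last by ring.
    rewrite ler_wpM2r // addr_ge0 ?nested_geometric_sum_ge0 //.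
    by rewrite mulr_ge0 ?geometric_sum_ge0.
  have : q * (q * nested + 2 * (q * geom)) <= q * (8 * q ^+ r) by rewrite ler_wpM2l //; lra.
  lra.
have q_le : 2 * q <= q ^+ 2 by rewrite expr2 ler_wpM2r //; lra.
have : 2 * q ^+ r <= q * q ^+ r by rewrite ler_wpM2r ?exprn_ge0 //; lra.
have d_eq : d.+1%:R = q + 1 by rewrite natr1.
have -> : (switch_loss d.+1 k)%:R = 2 * k%:R + 4 * d.+1%:R + 2 * d.+1%:R ^+ 2 :> R.
  by rewrite -natrX -!natrM -!natrD.
by move: d2_le sums_le; rewrite (exprS q r) d_eq; lra.
Qed.

(** * Inserting a subgraph *)

Lemma simple_graph_ind n (P : edge_set n -> Prop) : P set0 ->
    (forall (F : edge_set n) x y, x != y -> [set x; y] \notin F -> simple_graph F -> P F ->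
       P ([set x; y] |: F)) ->
  forall F, simple_graph F -> P F.
Proof.
move=> P0 PU1 F; have [k] := ubnP #|F|; elim: k => // k IHk in F * => F_lt simpleF.
have [->//|[f fF]] := set_0Vmem F.
have /cards2P[x [y [xy def_f]]] := forall_inP simpleF f fF.
have simpleF' : simple_graph (F :\ f) by apply: simple_subset simpleF; apply: subD1set.
have F'_lt : (#|F :\ f| < k)%N by move: F_lt; rewrite (cardsD1 f) fF.
have f_notin : f \notin F :\ f by rewrite setD11.
rewrite -(setD1K fF); rewrite {}def_f in f_notin simpleF' F'_lt *.
exact: PU1 (IHk _ F'_lt simpleF').
Qed.

Lemma bernoulli_le (R : realDomainType) (k : R) j : 0 <= k <= 1 ->
  1 - j%:R * k <= (1 - k) ^+ j.
Proof.
case/andP=> k_ge0 k_le1; elim: j => [|j IHj]; first by rewrite expr0 mul0r subr0.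
rewrite exprS; apply: le_trans (ler_wpM2l _ IHj); last by lra.
rewrite -natr1; have : 0 <= j%:R * k * k by rewrite !mulr_ge0.
lra.
Qed.

Section SubgraphWeight.
Variables (R : realFieldType) (n d : nat).
Implicit Types (F : edge_set n) (x y v : 'I_n).

Definition insertion_ratio F x y : R := (free_slots d F x y)%:R / (n * d)%:R.

Lemma insertion_ratio_ge0 F x y : 0 <= insertion_ratio F x y.
Proof. exact: divr_ge0. Qed.

(* The expected multiplicity of [F] in the configuration model, with the product
   [(n d - 1) (n d - 3) ...] replaced by a power of [n d]. *)
Definition subgraph_weight F : R :=
  (\prod_v d ^_ (degree F v))%:R / (n * d)%:R ^+ #|F|.

Lemma subgraph_weight0 : subgraph_weight set0 = 1.
Proof.
rewrite /subgraph_weight cards0 expr0 divr1 big1 // => v _.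
by rewrite degree_sum big_set0 ffactn0.
Qed.

Lemma subgraph_weight_setU1 F x y : x != y -> [set x; y] \notin F ->
  subgraph_weight ([set x; y] |: F) = insertion_ratio F x y * subgraph_weight F.
Proof.
move=> xy xyF; rewrite /subgraph_weight /insertion_ratio cardsU1 xyF add1n exprS invfM.
have -> : (\prod_v d ^_ degree ([set x; y] |: F) v =
    free_slots d F x y * \prod_v d ^_ degree F v)%N.
  have yx : y != x by rewrite eq_sym.
  rewrite (bigD1 x) // (bigD1 y) //= [in RHS](bigD1 x) // [in RHS](bigD1 y) //=.
  rewrite !(degree_setU1 _ xyF) set21 set22 !add1n !ffactnSr /free_slots.
  set rest := (\prod_(v | _) d ^_ degree F v)%N.
  suff -> : (\prod_(v | (v != x) && (v != y)) d ^_ degree ([set x; y] |: F) v = rest)%N.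
    by ring.
  apply: eq_bigr => v /andP[vx vy].
  by rewrite degree_setU1 // in_set2 (negPf vx) (negPf vy).
by rewrite natrM; ring.
Qed.

Lemma subgraph_weight_cycle c : (0 < d)%N -> uniq c -> (3 <= size c)%N ->
  subgraph_weight (cycle_edges c) = (d.-1%:R / n%:R) ^+ size c.
Proof.
move=> d_gt0 Uc c3; rewrite /subgraph_weight card_cycle_edges //.
have -> : (\prod_v d ^_ degree (cycle_edges c) v = (d * d.-1) ^ size c)%N.
  rewrite -(card_uniqP Uc) -prod_nat_const [RHS]big_mkcond; apply: eq_bigr => v _.
  by rewrite degree_cycle_edges //; case: (v \in c); rewrite // muln1 ffactnS ffactn1.
rewrite natrX -exprVn -exprMn; congr (_ ^+ _).
by rewrite [(n * d)%N]mulnC !natrM -mulf_div divff ?mul1r // pnatr_eq0 -lt0n.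
Qed.

End SubgraphWeight.

Section SubgraphInsertion.
Variables (R : realFieldType) (n d r : nat).
Hypotheses (d_ge3 : (3 <= d)%N) (r_ge3 : (3 <= r)%N).
Hypothesis size_nd : (2 * (r * switch_loss d r) <= n * d)%N.
Implicit Types (F G E : edge_set n) (x y v : 'I_n).
Local Notation graph_sum := (@graph_sum R n d).
Local Notation graph_count := (@graph_count R n d).
Local Notation weight := (@subgraph_weight R n d).
Local Notation ratio := (@insertion_ratio R n d).

Let loss_rate : R := (switch_loss d r)%:R / (n * d)%:R.
Let edge_error : R := 300 * (d.-1%:R ^+ r.-1 / n%:R).

Let d_gt0 : (0 < d)%N. Proof. exact: leq_trans d_ge3. Qed.

Let nd_gt0 : 0 < (n * d)%:R :> R.
Proof.
rewrite ltr0n; apply: leq_trans size_nd; rewrite !muln_gt0 /=.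
by rewrite (leq_trans _ r_ge3) // /switch_loss !addn_gt0 !muln_gt0 d_gt0 orbT.
Qed.

Lemma loss_rate_bounds j : (j <= r)%N -> 0 <= loss_rate <= 1 /\ 2^-1 <= (1 - loss_rate) ^+ j.
Proof.
move=> jr; have loss_rate_ge0 : 0 <= loss_rate by rewrite /loss_rate divr_ge0.
have r_loss_rate : r%:R * loss_rate <= 2^-1.
  by rewrite /loss_rate mulrA ler_pdivrMr // ler_pdivlMl // -!natrM ler_nat.
have loss_rate_le1 : loss_rate <= r%:R * loss_rate.
  by rewrite -[leLHS]mul1r ler_wpM2r // ler1n (leq_trans _ r_ge3).
have loss_rate01 : 0 <= loss_rate <= 1 by rewrite loss_rate_ge0 /=; lra.
split=> //; apply: le_trans (bernoulli_le j loss_rate01).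
have : j%:R * loss_rate <= r%:R * loss_rate by rewrite ler_wpM2r // ler_nat.
lra.
Qed.

Lemma graph_count_weight F : simple_graph F -> (#|F| <= r)%N ->
  graph_count F * (1 - loss_rate) ^+ #|F| <= weight F * graph_count set0.
Proof.
move: F; apply: simple_graph_ind => [|F x y xy xyF _ IHF].
  by rewrite cards0 expr0 subgraph_weight0 mulr1 mul1r.
rewrite cardsU1 xyF add1n => F_lt.
have [/andP[_ loss_rate_le1] _] := loss_rate_bounds (leqnn r).
have insertion : graph_count ([set x; y] |: F) * (1 - loss_rate) <=
    ratio F x y * graph_count F.
  rewrite /insertion_ratio mulrAC ler_pdivlMr // -mulrA mulrBl mul1r /loss_rate divfK ?gt_eqF //.
  rewrite mulrC mulrBl lerBlDr; apply: le_trans (edge_insertion R d xyF) _.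
  by rewrite lerD2l ler_wpM2r ?graph_count_ge0 // ler_nat leq_switch_loss // ltnW.
rewrite subgraph_weight_setU1 // exprS mulrA.
apply: le_trans (ler_wpM2r _ insertion) _; first by rewrite exprn_ge0 // subr_ge0.
by rewrite -[leLHS]mulrA -[leRHS]mulrA ler_wpM2l ?insertion_ratio_ge0 // IHF // ltnW.
Qed.

Lemma graph_count_le_weight F : simple_graph F -> (#|F| <= r)%N ->
  graph_count F <= 2 * (weight F * graph_count set0).
Proof.
move=> simpleF F_le; have [_ half_le] := loss_rate_bounds F_le.
rewrite -ler_pdivrMl // mulrC; apply: le_trans (graph_count_weight simpleF F_le).
by rewrite ler_wpM2l ?graph_count_ge0.
Qed.

Variable C : {set edge_set n}.
Hypothesis C_short : short_cycles r C.
Variable h : edge_set n -> R.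
Hypotheses (h_det : determined_by C h) (h_le1 : forall G, `|h G| <= 1).

Lemma free_slots_ge F x y : x != y -> [set x; y] \notin F ->
    (forall v, degree ([set x; y] |: F) v <= 2)%N ->
  (d.-1 ^ 2 <= free_slots d F x y)%N.
Proof.
move=> xy xyF degF; have := degF x; have := degF y.
rewrite !degree_setU1 // set21 set22 !add1n !ltnS => degy degx.
by rewrite /free_slots -mulnn -subn1 leq_mul // leq_sub2l.
Qed.

Lemma edge_insertion_relative_error F x y : x != y -> [set x; y] \notin F ->
    simple_graph ([set x; y] |: F) -> (forall v, degree ([set x; y] |: F) v <= 2)%N ->
    (forall E, E \in C -> ~~ (E \subset [set x; y] |: F)) -> (#|F| < r)%N ->
  `|graph_sum h ([set x; y] |: F) - ratio F x y * graph_sum h F| <=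
  ratio F x y * edge_error * graph_count F.
Proof.
move=> xy xyF simpleF0 degF0 no_cycle F_lt; have r_ge2 : (2 <= r)%N by apply: ltnW.
have loss_le : (2 * switch_loss d (#|F|.+1 + r) <= n * d)%N.
  apply: leq_trans size_nd; rewrite leq_pmul2l //.
  by clear -F_lt r_ge2; rewrite /switch_loss; nia.
have := edge_insertion_error C_short r_ge2 xyF simpleF0 degF0 no_cycle loss_le h_det h_le1.
set slots := (free_slots _ _ _ _)%:R => absolute_error.
have ratioE z : ratio F x y * z = (n * d)%:R^-1 * (slots * z).
  by rewrite mulrA [_^-1 * _]mulrC.
rewrite -[_ * edge_error * _]mulrA !ratioE -[graph_sum h (_ |: F)](mulKf (lt0r_neq0 nd_gt0)).
rewrite -mulrBr normrM gtr0_norm ?invr_gt0 // ler_pM2l ?invr_gt0 //.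
apply: le_trans absolute_error _; rewrite mulrA.
rewrite ler_wpM2r ?graph_count_ge0 //.
apply: (@le_trans _ _ (d.-1%:R ^+ 2 * edge_error)); last first.
  rewrite ler_wpM2r ?mulr_ge0 ?invr_ge0 ?exprn_ge0 //.
  by rewrite -natrX ler_nat free_slots_ge.
have := switching_error_le R d_ge3 r_ge3 (ltnW F_lt).
set q : R := d.-1%:R; set err := switching_error _ _ _ _ => err_le.
have d_le : 2 * d%:R <= 3 * q by rewrite -!natrM ler_nat; clear -d_ge3; lia.
have q_ge0 : 0 <= q by [].
rewrite [leRHS](_ : _ = 3 * q * (100 * q ^+ r) / n%:R); last first.
  have -> : q ^+ r = q * q ^+ r.-1 by rewrite -exprS (ltn_predK r_ge3).
  by rewrite /edge_error -/q; ring.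
by rewrite mulrAC ler_wpM2r ?invr_ge0 // ler_pM ?mulr_ge0 ?switching_error_ge0.
Qed.

Theorem graph_sum_weight F : simple_graph F -> (forall v, degree F v <= 2)%N ->
    (forall E, E \in C -> ~~ (E \subset F)) -> (#|F| <= r)%N ->
  `|graph_sum h F - weight F * graph_sum h set0| <=
  2 * edge_error * #|F|%:R * weight F * graph_count set0.
Proof.
move: F; apply: simple_graph_ind => [|F x y xy xyF simpleF IHF] degF0 no_cycle.
  by rewrite cards0 subgraph_weight0 mul1r subrr normr0 mulr0 !mul0r.
have FF0 : F \subset [set x; y] |: F by apply: subsetUr.
rewrite cardsU1 xyF add1n => F_lt; rewrite subgraph_weight_setU1 //.
have simpleF0 : simple_graph ([set x; y] |: F).
  apply/forall_inP => f; rewrite in_setU1 => /orP[/eqP->|fF]; first by rewrite cards2 xy.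
  exact: (forall_inP simpleF).
have step := edge_insertion_relative_error xy xyF simpleF0 degF0 no_cycle F_lt.
have {IHF} := IHF (fun v => leq_trans (degree_subset v FF0) (degF0 v)).
have no_cycleF E : E \in C -> ~~ (E \subset F).
  by move=> /no_cycle; apply: contra => /subset_trans; apply.
move=> /(_ no_cycleF (ltnW F_lt)) IHF; have rho_ge0 := insertion_ratio_ge0 R d F x y.
set rho := ratio F x y in step rho_ge0 *.
have eps_ge0 : 0 <= edge_error by rewrite !mulr_ge0 ?invr_ge0 ?exprn_ge0.
have count_le := graph_count_le_weight simpleF (ltnW F_lt).
rewrite [X in `|X|](_ : _ = (graph_sum h ([set x; y] |: F) - rho * graph_sum h F)
  + rho * (graph_sum h F - weight F * graph_sum h set0)); last by ring.
apply: le_trans (ler_normD _ _) _; rewrite normrM (ger0_norm rho_ge0).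
apply: le_trans (lerD step (ler_wpM2l rho_ge0 IHF)) _.
have := ler_wpM2l (mulr_ge0 rho_ge0 eps_ge0) count_le.
by rewrite -natr1; lra.
Qed.

Corollary graph_sum_cycle c : uniq c -> (3 <= size c)%N -> (size c <= r)%N ->
    (forall E, E \in C -> E != cycle_edges c) ->
  `|graph_sum h (cycle_edges c) - (d.-1%:R / n%:R) ^+ size c * graph_sum h set0| <=
  600 * (d.-1%:R ^+ r.-1 / n%:R) * (size c)%:R * (d.-1%:R / n%:R) ^+ size c
    * graph_count set0.
Proof.
move=> Uc c3 c_le no_cycle; rewrite -subgraph_weight_cycle // -(card_cycle_edges Uc c3).
rewrite [600](_ : _ = 2 * 300); last by ring.
rewrite -(mulrA 2 300); apply: graph_sum_weight; rewrite ?card_cycle_edges //.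
- exact: simple_cycle_edges.
- by move=> v; rewrite degree_cycle_edges //; case: (v \in c).
- move=> E EC; apply: contra (no_cycle E EC) => Ec; apply/eqP.
  have [[s [Us s3 def_E]] _] := C_short EC; rewrite def_E in Ec *.
  exact: cycle_edges_subset_eq.
Qed.

End SubgraphInsertion.

(** * Replacing one coordinate at a time *)

Lemma setD_eq_setU1 (T : finType) (a : T) (S V W : {set T}) : a \notin S ->
  (V :\: S == (a |: W) :\: S) = (a \in V) && (V :\: (a |: S) == W :\: (a |: S)).
Proof.
move=> aS; apply/eqP/andP => [/setP eqVW|[aV /eqP/setP eqVW]].
  split; first by have := eqVW a; rewrite !inE aS eqxx /= => ->.
  by apply/eqP/setP => u; have := eqVW u; rewrite !inE; case: (u == a).
apply/setP => u; have := eqVW u; rewrite !inE; have [->|] := eqVneq u a => //=.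
by rewrite aV.
Qed.

Lemma setD_eq_setD1 (T : finType) (a : T) (S V W : {set T}) : a \notin S ->
  (V :\: S == (W :\ a) :\: S) = (a \notin V) && (V :\: (a |: S) == W :\: (a |: S)).
Proof.
move=> aS; apply/eqP/andP => [/setP eqVW|[aV /eqP/setP eqVW]].
  split; first by have := eqVW a; rewrite !inE aS eqxx /= => ->.
  by apply/eqP/setP => u; have := eqVW u; rewrite !inE; case: (u == a).
apply/setP => u; have := eqVW u; rewrite !inE; have [->|] := eqVneq u a => //=.
by rewrite (negPf aV).
Qed.

Section Resampling.
Variables (R : numDomainType) (I : finType) (p0 p1 : I -> R).
Implicit Types (a : I) (f : {set I} -> R) (W V : {set I}) (s : seq I).

Definition resample a f W : R := p0 a * f (W :\ a) + p1 a * f (a |: W).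

Definition pattern_weight s V : R := \prod_(a <- s) (if a \in V then p1 a else p0 a).

Lemma foldr_resample s f W : uniq s -> foldr resample f s W =
  \sum_(V : {set I} | V :\: [set:: s] == W :\: [set:: s]) pattern_weight s V * f V.
Proof.
elim: s W => [|a s IHs] W /=.
  move=> _; rewrite set_nil (big_pred1 W); last by move=> V; rewrite /= !setD0.
  by rewrite /pattern_weight big_nil mul1r.
case/andP=> as_ Us; have a_notin : a \notin [set:: s] by rewrite inE.
rewrite /resample !IHs // !mulr_sumr set_cons.
rewrite [X in X + _ = _]big_mkcond [X in _ + X = _]big_mkcond -big_split.
rewrite [RHS]big_mkcond /=; apply: eq_bigr => V _.
rewrite /pattern_weight big_cons setD_eq_setU1 ?setD_eq_setD1 //.
by case: (a \in V) => /=; case: ifP => _; rewrite ?addr0 ?add0r ?mulrA.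
Qed.

Hypothesis p0_ge0 : forall a, 0 <= p0 a.
Hypothesis p1_ge0 : forall a, 0 <= p1 a.
Hypothesis p_le1 : forall a, p0 a + p1 a <= 1.

Lemma norm_resample_le1 a f : (forall W, `|f W| <= 1) -> forall W, `|resample a f W| <= 1.
Proof.
move=> f_le1 W; apply: le_trans (p_le1 a); apply: le_trans (ler_normD _ _) _.
by rewrite !normrM !(ger0_norm (p0_ge0 _)) !(ger0_norm (p1_ge0 _)) lerD // ler_piMr.
Qed.

Lemma foldr_resample_error (T : finType) (D : {pred T}) (X : T -> {set I}) (err : I -> R) s f :
    (forall a f, a \in s -> (forall W, `|f W| <= 1) ->
       `|\sum_(t in D) f (X t) - \sum_(t in D) resample a f (X t)| <= err a) ->
    (forall W, `|f W| <= 1) ->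
  `|\sum_(t in D) f (X t) - \sum_(t in D) foldr resample f s (X t)| <= \sum_(a <- s) err a.
Proof.
move=> + f_le1; elim: s => [|a s IHs] step_error /=; first by rewrite subrr normr0 big_nil.
have foldr_le1 W : `|foldr resample f s W| <= 1.
  by elim: (s) W => //= b s' IHs'; apply: norm_resample_le1.
apply: le_trans (ler_distD (\sum_(t in D) foldr resample f s (X t)) _ _) _.
rewrite big_cons addrC lerD //; first by apply: step_error; rewrite ?mem_head.
by apply: IHs => b g bs; apply: step_error; rewrite inE bs orbT.
Qed.

End Resampling.

Section CyclesIn.
Variable n : nat.
Implicit Types (A E G : edge_set n) (C : {set edge_set n}).

Definition cycles_in C G : {set edge_set n} := [set E in C | E \subset G].

Lemma determined_cycles_in (R : Type) C (f : {set edge_set n} -> R) :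
  determined_by C (fun G => f (cycles_in C G)).
Proof.
move=> G G' same; congr f; apply/setP => E; rewrite !inE.
by case: (boolP (E \in C)) => // /same ->.
Qed.

Lemma cycles_in_setD1 C A G : cycles_in (C :\ A) G = cycles_in C G :\ A.
Proof. by apply/setP => E; rewrite !inE andbA. Qed.

Lemma setU1_cycles_in C A G : A |: cycles_in C G = A |: cycles_in (C :\ A) G.
Proof. by apply/setP => E; rewrite !inE; case: eqP. Qed.

Lemma cycles_in_split C A G : A \in C -> cycles_in C G =
  if A \subset G then A |: cycles_in (C :\ A) G else cycles_in (C :\ A) G.
Proof.
move=> A_in; case: ifPn => AG; first by rewrite -setU1_cycles_in (setUidPr _) // sub1set inE A_in.
by apply/setP => E; rewrite !inE; case: eqP => // ->; rewrite (negPf AG) andbF.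
Qed.

Lemma graph_sum_split (R : realFieldType) d A (h0 h1 : edge_set n -> R) :
  graph_sum d (fun G => if A \subset G then h1 G else h0 G) set0 =
  graph_sum d h0 set0 - graph_sum d h0 A + graph_sum d h1 A.
Proof.
rewrite !graph_sum0 /graph_sum [X in _ - X + _]big_mkcondr [X in _ + X]big_mkcondr /=.
rewrite -sumrB -big_split /=; apply: eq_bigr => G _.
by case: ifP => _; rewrite ?subrr ?add0r ?subr0 ?addr0.
Qed.

End CyclesIn.

(* [g0], [g1] are the sums of [f] over all graphs with the coordinate forced to be
   absent or present, and [g0A], [g1A] their parts where it is really present. *)
Lemma mixture_error (R : realDomainType) (g0 g0A g1 g1A mu lam p0 p1 e delta N : R) :
    `|g0A - mu * g0| <= e -> `|g1A - mu * g1| <= e -> `|g0| <= N -> `|g1| <= N ->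
    `|1 - lam - p0| <= delta -> `|lam - p1| <= delta ->
  `|g0 - g0A + g1A - (p0 * g0 + p1 * g1)| <= 2 * e + 2 * (`|lam - mu| + delta) * N.
Proof.
move=> insertion0 insertion1 norm0 norm1 p0_close p1_close.
have -> : g0 - g0A + g1A - (p0 * g0 + p1 * g1) = (g1A - mu * g1) - (g0A - mu * g0)
    + (1 - lam - p0 + (lam - mu)) * g0 + (mu - lam + (lam - p1)) * g1 by ring.
have coef0 : `|(1 - lam - p0 + (lam - mu)) * g0| <= (`|lam - mu| + delta) * N.
  by rewrite normrM ler_pM // (le_trans (ler_normD _ _)) // addrC lerD.
have coef1 : `|(mu - lam + (lam - p1)) * g1| <= (`|lam - mu| + delta) * N.
  by rewrite normrM ler_pM // (le_trans (ler_normD _ _)) // lerD // distrC.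
apply: le_trans (ler_normD _ _) _; apply: le_trans (lerD (ler_normD _ _) coef1) _.
apply: le_trans (lerD (lerD (ler_normB _ _) coef0) (lexx _)) _.
lra.
Qed.

Section ResamplingCycles.
Variables (R : realFieldType) (n d r : nat) (C : {set edge_set n}).
Hypothesis C_short : short_cycles r C.
Hypotheses (d_ge3 : (3 <= d)%N) (r_ge3 : (3 <= r)%N).
Hypothesis size_nd : (2 * (r * switch_loss d r) <= n * d)%N.
Implicit Types (A E G : edge_set n) (f : {set edge_set n} -> R).
Local Notation graph_sum := (@graph_sum R n d).
Local Notation N := (@graph_count R n d set0).

Lemma cycle_insertion_error A f (mu := (d.-1%:R / n%:R) ^+ cycle_length A) :
    A \in C -> (forall W, `|f W| <= 1) ->
  `|graph_sum (fun G => f (cycles_in (C :\ A) G)) A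
    - mu * graph_sum (fun G => f (cycles_in (C :\ A) G)) set0| <=
  600 * (d.-1%:R ^+ r.-1 / n%:R) * (cycle_length A)%:R * mu * N.
Proof.
move=> A_in f_le1; have [[c [Uc c3 def_A]] len_A] := C_short A_in.
have lenE : cycle_length A = size c by rewrite /cycle_length def_A card_cycle_edges.
rewrite /mu lenE {2}def_A; rewrite lenE in len_A.
have CA_short : short_cycles r (C :\ A) by move=> E /setD1P[_]; apply: C_short.
apply: (graph_sum_cycle d_ge3 r_ge3 size_nd CA_short) => // [|E /setD1P[EA _]].
  exact: determined_cycles_in.
by rewrite -def_A.
Qed.

Lemma resample_error p0 p1 (lam : R) A f (mu := (d.-1%:R / n%:R) ^+ cycle_length A) :
    A \in C -> `|1 - lam - p0 A| <= lam ^+ 2 -> `|lam - p1 A| <= lam ^+ 2 ->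
    (forall W, `|f W| <= 1) ->
  `|graph_sum (fun G => f (cycles_in C G)) set0 -
    graph_sum (fun G => resample p0 p1 A f (cycles_in C G)) set0| <=
  (1200 * (d.-1%:R ^+ r.-1 / n%:R) * (cycle_length A)%:R * mu
    + 2 * `|lam - mu| + 2 * lam ^+ 2) * N.
Proof.
move=> A_in p0_close p1_close f_le1.
pose h0 G := f (cycles_in (C :\ A) G); pose h1 G := f (A |: cycles_in (C :\ A) G).
have insertion0 := cycle_insertion_error A_in f_le1.
have insertion1 := cycle_insertion_error A_in (fun W => f_le1 (A |: W)).
rewrite -/mu -/h0 -/h1 in insertion0 insertion1.
have norm_le (h : edge_set n -> R) : (forall G, `|h G| <= 1) -> `|graph_sum h set0| <= N.
  by move=> h_le1; apply: le_trans (norm_graph_sum _ _ _) _; apply: ler_graph_sum.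
have norm0 : `|graph_sum h0 set0| <= N by apply: norm_le => G; apply: f_le1.
have norm1 : `|graph_sum h1 set0| <= N by apply: norm_le => G; apply: f_le1.
have -> : graph_sum (fun G => f (cycles_in C G)) set0 =
    graph_sum h0 set0 - graph_sum h0 A + graph_sum h1 A.
  rewrite -graph_sum_split; apply: eq_bigr => G _.
  by rewrite (cycles_in_split G A_in) (fun_if f).
have -> : graph_sum (fun G => resample p0 p1 A f (cycles_in C G)) set0 =
    p0 A * graph_sum h0 set0 + p1 A * graph_sum h1 set0.
  rewrite -!graph_sumZ -graph_sumD; apply: eq_bigr => G _.
  by rewrite /resample -cycles_in_setD1 setU1_cycles_in.
apply: le_trans (mixture_error insertion0 insertion1 norm0 norm1 p0_close p1_close) _.
by apply: eq_ler; ring.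
Qed.

End ResamplingCycles.

(** * Comparing the rates *)

Lemma ffact_le_expn n k : (n ^_ k <= n ^ k)%N.
Proof.
rewrite ffact_prod -[X in (_ ^ X)%N]card_ord -prod_nat_const.
by apply: leq_prod => i _; apply: leq_subr.
Qed.

Lemma ffact_ge_expn n k : ((n - k) ^ k <= n ^_ k)%N.
Proof.
rewrite ffact_prod -[X in (_ ^ X)%N]card_ord -prod_nat_const.
by apply: leq_prod => i _; apply: leq_sub2l; apply: ltnW.
Qed.

Lemma ffact_ge_expr (R : realFieldType) n k : (k <= n)%N -> (0 < n)%N ->
  n%:R ^+ k * (1 - (k ^ 2)%:R / n%:R) <= (n ^_ k)%:R :> R.
Proof.
move=> kn n_gt0; have nR : 0 < n%:R :> R by rewrite ltr0n.
apply: (@le_trans _ _ ((n - k)%N%:R ^+ k)); last by rewrite -natrX ler_nat ffact_ge_expn.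
have -> : (n - k)%N%:R = n%:R * (1 - k%:R / n%:R) :> R.
  by rewrite natrB // mulrBr mulr1 mulrCA divff ?gt_eqF // mulr1.
rewrite exprMn ler_pM2l ?exprn_gt0 // natrX expr2 -mulrA.
by apply: bernoulli_le; rewrite divr_ge0 //= ler_pdivrMr // mul1r ler_nat.
Qed.

Section Rates.
Variables (R : realFieldType) (q : R) (n k : nat).
Hypotheses (q_ge0 : 0 <= q) (n_gt0 : (0 < n)%N) (k_small : (2 * k ^ 2 <= n)%N).

Let n_gt0R : 0 < n%:R :> R. Proof. by rewrite ltr0n. Qed.

Let mu : R := (q / n%:R) ^+ k.
Let lam : R := q ^+ k / (n ^_ k)%:R.
Let t : R := (k ^ 2)%:R / n%:R.

Let mu_ge0 : 0 <= mu. Proof. by rewrite exprn_ge0 // divr_ge0. Qed.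

Let k_le_n : (k <= n)%N.
Proof. by move: k_small; rewrite -mulnn; nia. Qed.

Lemma ffact_rate_bounds : mu <= lam /\ lam * (1 - t) <= mu.
Proof.
have ff_gt0 : 0 < (n ^_ k)%:R :> R by rewrite ltr0n ffact_gt0.
have nX_gt0 : 0 < n%:R ^+ k :> R by rewrite exprn_gt0.
have lam_ge0 : 0 <= lam by rewrite divr_ge0 ?exprn_ge0.
have lamE : lam * (n ^_ k)%:R = mu * n%:R ^+ k.
  by rewrite /lam /mu exprMn exprVn !divfK ?gt_eqF.
split; first by rewrite -(ler_pM2r ff_gt0) lamE ler_wpM2l // -natrX ler_nat ffact_le_expn.
by rewrite -(ler_pM2r nX_gt0) -lamE -mulrA ler_wpM2l // mulrC ffact_ge_expr.
Qed.

Lemma ffact_rate_close : `|lam - mu| <= 2 * t * mu /\ lam <= 2 * mu.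
Proof.
have [mu_le lam_le] := ffact_rate_bounds.
have t_ge0 : 0 <= t by rewrite divr_ge0.
have t_le : 2 * t <= 1 by rewrite /t mulrA ler_pdivrMr // mul1r -natrM ler_nat.
have : 2 * t * lam <= lam by rewrite -[leRHS]mul1r ler_wpM2r // (le_trans mu_ge0).
move=> half_le; have lam_le2 : lam <= 2 * mu by lra.
split=> //; rewrite ger0_norm ?subr_ge0 //.
have : t * lam <= t * (2 * mu) by rewrite ler_wpM2l.
lra.
Qed.

End Rates.

Lemma cycle_error_le (R : realFieldType) (q : R) (n k r : nat)
    (mu := (q / n%:R) ^+ k) (lam := q ^+ k / (n ^_ k)%:R) :
    2 <= q -> q <= n%:R -> (1 <= k)%N -> (k <= r)%N -> (3 <= r)%N -> (2 * r ^ 2 <= n)%N ->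
  1200 * (q ^+ r.-1 / n%:R) * k%:R * mu + 2 * `|lam - mu| + 2 * lam ^+ 2 <=
  1212 * k%:R * q ^+ (k + r - 1) / n%:R ^+ (k + 1).
Proof.
move=> q_ge2 qn k_gt0 kr r_ge3 rn; have q_ge0 : 0 <= q by lra.
have nR : 0 < n%:R :> R by lra.
have n_gt0 : (0 < n)%N by rewrite -(ltr0n R).
have k_small : (2 * k ^ 2 <= n)%N by apply: leq_trans rn; rewrite leq_pmul2l // leq_sqr.
have [close lam_le] := ffact_rate_close q_ge0 n_gt0 k_small.
rewrite -/mu -/lam in close lam_le.
pose T := q ^+ r.-1 / n%:R.
have -> : 1212 * k%:R * q ^+ (k + r - 1) / n%:R ^+ (k + 1) = 1212 * (k%:R * mu * T).
  rewrite -addnBA ?(ltnW (ltnW r_ge3)) // subn1 /mu /T exprMn exprVn !exprD expr1 invfM; ring.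
have mu_ge0 : 0 <= mu by rewrite exprn_ge0 // divr_ge0.
have T_ge0 : 0 <= T by rewrite divr_ge0 ?exprn_ge0.
have k_le : k%:R / n%:R <= T.
  rewrite ler_pM2r ?invr_gt0 //; apply: (@le_trans _ _ (2 ^+ r.-1)).
    rewrite -natrX ler_nat; apply: leq_trans kr _.
    by rewrite -{1}(ltn_predK r_ge3) ltn_expl.
  by rewrite lerXn2r ?nnegrE.
have mu_le : mu <= T.
  apply: (@le_trans _ _ (q / n%:R)).
    rewrite /mu -(prednK k_gt0) exprS ler_piMr ?divr_ge0 // exprn_ile1 ?divr_ge0 //.
    by rewrite ler_pdivrMr // mul1r.
  rewrite ler_pM2r ?invr_gt0 // -[leLHS]expr1 ler_weXn2l //; first by lra.
  by rewrite -ltnS (ltn_predK r_ge3) ltnW.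
have lam_mu_le : `|lam - mu| <= 2 * (k%:R * mu * T).
  apply: le_trans close _; rewrite [leLHS](_ : _ = 2 * (k%:R * mu * (k%:R / n%:R))).
    by rewrite ler_pM2l // ler_wpM2l ?mulr_ge0.
  by rewrite natrX; ring.
have lam_ge0 : 0 <= lam by rewrite divr_ge0 ?exprn_ge0.
have lam2_le : lam ^+ 2 <= 4 * (k%:R * mu * T).
  apply: (@le_trans _ _ ((2 * mu) ^+ 2)); first by rewrite lerXn2r // nnegrE mulr_ge0.
  rewrite [leLHS](_ : _ = 4 * (1 * mu * mu)); last by ring.
  by rewrite ler_pM2l // ler_pM ?mulr_ge0 // ler_wpM2r // ler1n.
rewrite -/T; lra.
Qed.

Lemma regime_bounds n d r : (3 <= d)%N -> (3 <= r)%N -> (r ^ 10 <= n)%N -> (d ^ 3 <= n)%N ->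
  (2 * (r * switch_loss d r) <= n * d)%N /\ (2 * r ^ 2 <= n)%N.
Proof.
move=> d_ge3 r_ge3 rn dn.
have r2_le : (144 * r ^ 2 <= n)%N.
  apply: leq_trans rn; rewrite -[10%N]/(8 + 2)%N expnD leq_mul2r; apply/orP; right.
  by apply: (@leq_trans (3 ^ 8)); rewrite ?leq_exp2r.
have rd_le : (12 * (r * d) <= n)%N.
  rewrite -leq_sqr expnMn expnMn mulnA -[(n ^ 2)%N]mulnn leq_mul //.
  by apply: leq_trans dn; rewrite leq_pexp2l // (leq_trans _ d_ge3).
split; last by apply: leq_trans r2_le; rewrite leq_mul2r orbT.
have rdd_le : (12 * (r * d) * d <= n * d)%N by rewrite leq_mul2r rd_le orbT.
have rd_small : (24 * (r * d) <= n * d)%N.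
  rewrite mulnA leq_mul2r; apply/orP; right; apply: leq_trans r2_le.
  by rewrite -mulnn mulnA leq_mul2r (@leq_trans (144 * 1)) ?orbT // leq_mul // ltnW // ltnW.
have rr_small : (12 * r ^ 2 <= n * d)%N.
  apply: leq_trans (leq_pmulr n (leq_trans _ d_ge3)) => //; apply: leq_trans r2_le.
  by rewrite leq_mul2r orbT.
rewrite /switch_loss [leqLHS](_ : _ = 4 * r ^ 2 + 8 * (r * d) + 4 * (r * d) * d)%N; last first.
  by rewrite -!mulnn; ring.
by move: rdd_le rd_small rr_small; clear; lia.
Qed.

Section CyclePatterns.
Variables (R : realFieldType) (n d r : nat) (C : {set edge_set n}).
Hypothesis C_short : short_cycles r C.
Hypotheses (d_ge3 : (3 <= d)%N) (r_ge3 : (3 <= r)%N).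
Hypotheses (r_le : (r ^ 10 <= n)%N) (d_le : (d ^ 3 <= n)%N).
Implicit Types (A E : edge_set n) (V : {set edge_set n}) (f : {set edge_set n} -> R).
Local Notation reg := (regular_graphs n d).

Definition cycle_rate A : R := (d%:R - 1) ^+ cycle_length A / (n ^_ cycle_length A)%:R.

Definition cycle_error A : R :=
  1212 * (cycle_length A)%:R * (d%:R - 1) ^+ (cycle_length A + r - 1)
    / n%:R ^+ (cycle_length A + 1).

Let predd : d.-1%:R = d%:R - 1 :> R.
Proof. by rewrite -subn1 natrB // ltnW // ltnW. Qed.

Lemma cycle_rate_ge0 A : 0 <= cycle_rate A.
Proof. by rewrite /cycle_rate -predd divr_ge0 ?exprn_ge0. Qed.

Variables p0 p1 : edge_set n -> R.
Hypothesis p0_close : forall A, `|1 - cycle_rate A - p0 A| <= cycle_rate A ^+ 2.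
Hypothesis p1_close : forall A, `|cycle_rate A - p1 A| <= cycle_rate A ^+ 2.

Lemma resample_error_le A f : A \in C -> (forall W, `|f W| <= 1) ->
  `|\sum_(G in reg) f (cycles_in C G) - \sum_(G in reg) resample p0 p1 A f (cycles_in C G)|
  <= cycle_error A * #|reg|%:R.
Proof.
move=> A_in f_le1; have [size_nd r2_le] := regime_bounds d_ge3 r_ge3 r_le d_le.
have := resample_error C_short d_ge3 r_ge3 size_nd A_in (p0_close A) (p1_close A) f_le1.
rewrite /graph_count !graph_sum0 sumr_const => /le_trans; apply; rewrite ler_wpM2r //.
have [[c [Uc c3 def_A]] len_A] := C_short A_in.
rewrite /cycle_error /cycle_rate -predd; apply: cycle_error_le => //.
- by rewrite (ler_nat R 2) -ltnS (ltn_predK d_ge3).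
- rewrite ler_nat; apply: leq_trans (leq_pred d) (leq_trans _ d_le).
  by rewrite -{1}(expn1 d) leq_pexp2l // ltnW // ltnW.
- by rewrite /cycle_length def_A card_cycle_edges // ltnW // ltnW.
Qed.

Hypotheses (p0_ge0 : forall A, 0 <= p0 A) (p1_ge0 : forall A, 0 <= p1 A).
Hypothesis p_le1 : forall A, p0 A + p1 A <= 1.

Lemma cycle_patterns_error f : (forall W, `|f W| <= 1) ->
  `|\sum_(G in reg) f (cycles_in C G)
    - #|reg|%:R * \sum_(V : {set edge_set n} | V \subset C) pattern_weight p0 p1 (enum C) V * f V|
  <= (\sum_(A in C) cycle_error A) * #|reg|%:R.
Proof.
move=> f_le1; set mean := (X in _ - _ * X).
have -> : #|reg|%:R * mean = \sum_(G in reg) foldr (resample p0 p1) f (enum C) (cycles_in C G).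
  rewrite /mean mulr_natl -sumr_const; apply: eq_bigr => G _.
  rewrite foldr_resample ?enum_uniq // set_enum; apply: eq_bigl => V.
  have /eqP -> : cycles_in C G :\: C == set0.
    by rewrite setD_eq0; apply/subsetP => E; rewrite inE => /andP[].
  by rewrite setD_eq0.
rewrite mulr_suml -[leRHS]big_enum; apply: foldr_resample_error => // A g.
by rewrite mem_enum; apply: resample_error_le.
Qed.

End CyclePatterns.

From mathcomp Require Import all_classical all_reals all_analysis.

(** * Discrete and Poisson laws *)

Lemma expRN_le (R : realType) (x : R) : 0 <= x -> expR (- x) <= 1 - x + x ^+ 2.
Proof.
move=> x_ge0; rewrite -(ler_pM2l (_ : 0 < 1 + x)); last by lra.
apply: (@le_trans _ _ 1).
  rewrite -[leRHS](_ : expR x * expR (- x) = 1); last by rewrite -expRD subrr expR0.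
  by rewrite ler_wpM2r ?expR_ge0 ?expR_ge1Dx.
rewrite [leRHS](_ : _ = 1 + x ^+ 3); last by ring.
by rewrite lerDl exprn_ge0.
Qed.

Lemma poisson_weights_close (R : realType) (lam : R) : 0 <= lam ->
  `|1 - lam - expR (- lam)| <= lam ^+ 2 /\ `|lam - lam * expR (- lam)| <= lam ^+ 2.
Proof.
move=> lam_ge0; have exp_ge := expR_ge1Dx (- lam); have exp_le := expRN_le lam_ge0.
have exp_le1 : expR (- lam) <= 1 by rewrite -expR0 ler_expR oppr_le0.
split; first by rewrite ler0_norm; lra.
rewrite [X in `|X|](_ : _ = lam * (1 - expR (- lam))); last by ring.
by rewrite ger0_norm ?mulr_ge0 ?subr_ge0 // expr2 ler_wpM2l //; lra.
Qed.

Lemma le_powR_inv_nat (R : realType) (m n k : nat) : (0 < k)%N ->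
  m%:R <= n%:R `^ (k%:R^-1) :> R -> (m ^ k <= n)%N.
Proof.
move=> k_gt0 m_le; rewrite -(ler_nat R) natrX.
have -> : n%:R = (n%:R `^ (k%:R^-1)) ^+ k :> R.
  by rewrite -powR_mulrn ?powR_ge0 // -powRrM mulVf ?powRr1 // pnatr_eq0 -lt0n.
by rewrite lerXn2r ?nnegrE ?powR_ge0.
Qed.

Section DiscreteLaws.
Context {R : realType} {dO : measure_display} {Omega : measurableType dO}.
Variable P : probability Omega R.
Local Open Scope classical_set_scope.
Local Open Scope ereal_scope.

Lemma measure_bigcup_finType (T : finType) (D : {pred T}) (F : T -> set Omega) :
    (forall t, measurable (F t)) -> trivIset [set` D] F ->
  P (\bigcup_(t in [set` D]) F t) = \sum_(t in D) P (F t).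
Proof.
move=> mF trivF; have finD : finite_set [set` D] by exact: finite_finset.
rewrite measure_fin_bigcup // (_ : [set` D] = [set` enum D]).
  by rewrite -fsbig_seq ?enum_uniq //= big_enum.
by apply/seteqP; split=> t /=; rewrite mem_enum.
Qed.

Section CountableValued.
Variables (S : countType) (X : Omega -> S).
Hypothesis X_measurable : forall x, measurable (X @^-1` [set x]).

Lemma measurable_preimage_countable (A : set S) : measurable (X @^-1` A).
Proof.
have -> : X @^-1` A = \bigcup_(x in A) X @^-1` [set x].
  by apply/seteqP; split=> [w Aw|w [x Ax /= ->]] //; exists (X w).
rewrite bigcup_mkcond; apply: countable_bigcupT_measurable; first exact: countableP.
by move=> x; case: ifP.
Qed.

Lemma sum_atoms_le (T : finType) (D : {pred T}) (g : T -> S) (A : set S) :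
    {in D &, injective g} -> (forall t, t \in D -> A (g t)) ->
  \sum_(t in D) P (X @^-1` [set g t]) <= P (X @^-1` A).
Proof.
move=> g_inj DA; rewrite -(measure_bigcup_finType (F := fun t => X @^-1` [set g t])) //.
  apply: le_measure; rewrite ?inE //; try exact: measurable_preimage_countable.
    exact: fin_bigcup_measurable.
  by move=> w [t /= tD ->]; apply: DA.
apply/trivIsetP => t t' /= tD t'D tt'; apply/seteqP; split=> // w /= [-> /(g_inj _ _ tD t'D)].
by move: tt' => /eqP.
Qed.

End CountableValued.

Lemma measure_preimage_finType (S : finType) (X : Omega -> S) (A : set S) :
    (forall x, measurable (X @^-1` [set x])) ->
  P (X @^-1` A) = \sum_(x | x \in A) P (X @^-1` [set x]).
Proof.
move=> mX; rewrite -(measure_bigcup_finType (F := fun x => X @^-1` [set x])) //.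
  congr (P _); apply/seteqP; split=> [w Aw|w [x /= /set_mem Ax ->]] //.
  by exists (X w) => //=; rewrite inE.
exact: trivIset_preimage1.
Qed.

Lemma uniform_law (S : finType) (B : {set S}) (X : Omega -> S) (A : set S) :
    uniform_on P B X ->
  P (X @^-1` A) = ((\sum_(x in B) (x \in A)%:R) / #|B|%:R)%:E.
Proof.
move=> X_unif; rewrite measure_preimage_finType; last by move=> x; case: (X_unif x).
rewrite (eq_bigr (fun x => (if x \in B then (#|B|%:R)^-1 else 0)%:E)%R); last first.
  by move=> x _; case: (X_unif x).
rewrite sumEFin mulr_suml; congr EFin.
rewrite [LHS]big_mkcond [RHS]big_mkcond; apply: eq_bigr => x _ /=.
by case: (x \in B); case: (x \in A); rewrite ?mul1r ?mul0r.
Qed.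

Lemma uniform_card_gt0 (S : finType) (B : {set S}) (X : Omega -> S) :
  uniform_on P B X -> (0 < #|B|)%N.
Proof.
move=> X_unif; rewrite lt0n; apply/eqP => B0; have := uniform_law setT X_unif.
rewrite preimage_setT probability_setT B0 invr0 mulr0 => /eqP.
by rewrite onee_eq0.
Qed.

Lemma expectation_nat (X : {RV P >-> nat}) :
  'E_P[fun w => (X w)%:R] = \sum_(0 <= k <oo) (k%:R)%:E * P (X @^-1` [set k]).
Proof.
have mX k : measurable (X @^-1` [set k]) by exact: measurable_funPTI.
have cover : \bigcup_k X @^-1` [set k] = setT.
  by apply/seteqP; split=> // w _; exists (X w).
rewrite unlock -cover ge0_integral_bigcup //; first last.
- exact: trivIset_preimage1.
- move=> _ Y mY; rewrite cover setTI.
  rewrite (_ : _ @^-1` Y = X @^-1` ((fun k : nat => (k%:R)%:E) @^-1` Y)) //.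
  exact: measurable_funPTI.
apply: eq_eseriesr => k _; rewrite (eq_integral (cst (k%:R)%:E)).
  by rewrite integral_cst.
by move=> w; rewrite inE /= => ->.
Qed.

Lemma poisson_expectation (X : {RV P >-> nat}) (rate : R) : (0 < rate)%R ->
    (forall k, P (X @^-1` [set k]) = (poisson_pmf rate k)%:E) ->
  'E_P[fun w => (X w)%:R] = rate%:E.
Proof.
move=> rate_gt0 X_law.
have pmf_sum : \sum_(0 <= k <oo) (poisson_pmf rate k)%:E = 1.
  rewrite -(probability_setT P) -(_ : \bigcup_k X @^-1` [set k] = setT); last first.
    by apply/seteqP; split=> // w _; exists (X w).
  rewrite measure_bigcup; first last.
  - exact: trivIset_preimage1.
  - by move=> k _; exact: measurable_funPTI.
  rewrite [RHS](eq_eseriesl (Q := xpredT)); last by move=> k; rewrite in_setT.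
  by apply: eq_eseriesr => k _; exact/esym/X_law.
rewrite expectation_nat.
rewrite (eq_eseriesr (g := fun k => (k%:R * poisson_pmf rate k)%:E)); last first.
  by move=> k _; rewrite EFinM; congr (_ * _); exact: X_law.
have term_ge0 k : 0 <= (k%:R * poisson_pmf rate k)%:E.
  by rewrite lee_fin mulr_ge0 ?poisson_pmf_ge0.
rewrite nneseries_recl //= mul0r add0e -nneseries_addn //.
rewrite (eq_eseriesr (g := fun k => rate%:E * (poisson_pmf rate k)%:E)); last first.
  move=> k _; rewrite -EFinM /poisson_pmf rate_gt0 addn1 factS natrM exprS; congr EFin.
  have k_neq0 : (k.+1%:R != 0 :> R)%R by rewrite pnatr_eq0.
  by rewrite invfM; move: (k.+1%:R : R) k_neq0 (k`!%:R^-1)%R => t t_neq0 u; field.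
by rewrite nneseriesZl ?pmf_sum ?mule1 // => k _; rewrite lee_fin poisson_pmf_ge0.
Qed.

Lemma poisson_pmf_of_mean (X : {RV P >-> nat}) (m : R) :
    is_poisson X -> 'E_P[fun w => (X w)%:R] = m%:E ->
  (0 < m)%R /\ forall k, P (X @^-1` [set k]) = (poisson_pmf m k)%:E.
Proof.
case=> rate rate_gt0 X_law; rewrite (poisson_expectation rate_gt0 X_law) => -[<-].
by split.
Qed.

End DiscreteLaws.

(** * Total variation distance *)

Lemma dTV_le_one_sided (R : realType) (dO dO2 : measure_display)
    (Omega : measurableType dO) (Omega2 : measurableType dO2)
    (P : probability Omega R) (Q : probability Omega2 R)
    (S : countType) (X : Omega -> S) (Y : Omega2 -> S) (b : R) :
    (forall A, measurable (X @^-1` A)%classic) -> (forall A, measurable (Y @^-1` A)%classic) ->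
    (forall A, fine (P (X @^-1` A)%classic) - fine (Q (Y @^-1` A)%classic) <= b) ->
  dTV P Q X Y <= b.
Proof.
move=> mX mY one_sided; apply: ge_sup; first by eexists; exists classical_sets.set0.
move=> _ [A _ <-]; rewrite ler_norml; apply/andP; split; last exact: one_sided.
have PC : P (X @^-1` (~` A))%classic = (1 - fine (P (X @^-1` A)%classic))%:E.
  by rewrite preimage_setC (probability_setC _ (mX A)) EFinB fineK ?fin_num_measure.
have QC : Q (Y @^-1` (~` A))%classic = (1 - fine (Q (Y @^-1` A)%classic))%:E.
  by rewrite preimage_setC (probability_setC _ (mY A)) EFinB fineK ?fin_num_measure.
have := one_sided (~` A)%classic; rewrite PC QC [fine (1 - _)%:E]/=.
rewrite [fine (1 - _)%:E in X in _ - X]/=.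
by move: (fine (P _)) (fine (Q _)) => x y; lra.
Qed.

Section JointLaw.
Context {R : realType} {dO : measure_display} {Omega : measurableType dO}.
Variables (Q : probability Omega R) (I : finType) (X : I -> {RV Q >-> nat}).
Local Open Scope classical_set_scope.

Let joint (w : Omega) : {ffun I -> nat} := [ffun i => X i w].

Let joint_preimage1 v : joint @^-1` [set v] =
  \bigcap_(i in [set i | i \in [set: I]%SET]) (X i @^-1` [set v i]).
Proof.
apply/seteqP; split=> w /= joint_v; first by move=> i _ /=; rewrite -joint_v ffunE.
by apply/ffunP => i; rewrite ffunE; apply: joint_v; rewrite /= finset.in_setT.
Qed.

Lemma measurable_joint A : measurable (joint @^-1` A).
Proof.
apply: measurable_preimage_countable => v; rewrite joint_preimage1.
apply: fin_bigcap_measurable; first exact: finite_finset.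
by move=> i _; exact: measurable_funPTI.
Qed.

Lemma joint_law v : mutually_independent X ->
  Q (joint @^-1` [set v]) = (\prod_i Q (X i @^-1` [set v i]))%E.
Proof.
move=> X_indep; rewrite joint_preimage1 X_indep; apply: eq_bigl => i.
exact: finset.in_setT.
Qed.

End JointLaw.

Section TotalVariation.
Variables (R : realType) (n d r : nat) (C : {set edge_set n}).
Context {dO dO2 : measure_display} {Omega : measurableType dO} {Omega2 : measurableType dO2}.
Variables (P : probability Omega R) (G : Omega -> edge_set n).
Variables (Q : probability Omega2 R) (Z : cycle_index C -> {RV Q >-> nat}).
Hypotheses (d_ge3 : (3 <= d)%N) (r_ge3 : (3 <= r)%N).
Hypotheses (r_le : (r ^ 10 <= n)%N) (d_le : (d ^ 3 <= n)%N).
Hypothesis G_uniform : uniform_on P (regular_graphs n d) G.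
Hypothesis C_short : short_cycles r C.
Hypothesis Z_poisson : forall a, is_poisson (Z a).
Hypothesis Z_mean : forall a, ('E_Q[fun w => (Z a w)%:R] = (cycle_rate R d (val a))%:E)%E.
Hypothesis Z_indep : mutually_independent Z.
Implicit Types (E : edge_set n) (V : {set edge_set n}) (A : set {ffun cycle_index C -> nat}).
Local Notation reg := (regular_graphs n d).

Definition pattern V : {ffun cycle_index C -> nat} :=
  [ffun a => nat_of_bool (val a \in V)].

Lemma cycle_indicators_pattern w :
  cycle_indicators C G w = pattern (cycles_in C (G w)).
Proof. by apply/ffunP => a; rewrite !ffunE /cycles_in finset.in_set /contains (valP a). Qed.

Lemma pattern_inj : {in [pred V : {set edge_set n} | V \subset C] &, injective pattern}.
Proof.
move=> V V' /fintype.subsetP VC /fintype.subsetP V'C /ffunP same; apply/setP => E.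
have [EC|EC] := boolP (E \in C).
  have := same (Sub E EC); rewrite !ffunE SubK.
  by case: (E \in V); case: (E \in V').
by rewrite (contraNF (VC E) EC) (contraNF (V'C E) EC).
Qed.

Local Open Scope classical_set_scope.

Let indicators_preimage A : cycle_indicators C G @^-1` A =
  G @^-1` [set g | A (pattern (cycles_in C g))].
Proof. by apply/seteqP; split=> w /=; rewrite cycle_indicators_pattern. Qed.

Lemma measurable_cycle_indicators A : measurable (cycle_indicators C G @^-1` A).
Proof.
rewrite indicators_preimage; apply: measurable_preimage_countable => g.
by case: (G_uniform g).
Qed.

Lemma cycle_indicators_law A : P (cycle_indicators C G @^-1` A) =
  ((\sum_(g in reg) (pattern (cycles_in C g) \in A)%:R) / #|reg|%:R)%:E.
Proof.
by rewrite indicators_preimage (uniform_law _ G_uniform).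
Qed.

Let p0 E : R := expR (- cycle_rate R d E).
Let p1 E : R := cycle_rate R d E * expR (- cycle_rate R d E).

Lemma pattern_law V : Q (joint_vector Z @^-1` [set pattern V]) =
  (pattern_weight p0 p1 (enum C) V)%:E.
Proof.
rewrite (joint_law _ Z_indep).
rewrite (eq_bigr (fun a => (if val a \in V then p1 (val a) else p0 (val a))%:E)); last first.
  move=> a _; have [rate_gt0 law] := poisson_pmf_of_mean (Z_poisson a) (Z_mean a).
  rewrite ffunE law; congr EFin; rewrite /poisson_pmf rate_gt0.
  by case: ifP => _ /=; rewrite ?fact0 ?expr0 ?expr1 invr1 mulr1 ?mul1r.
rewrite prodEFin; congr EFin; rewrite /pattern_weight.
rewrite [RHS](perm_big (map val (enum {: cycle_index C}))) /=; last first.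
  rewrite perm_sym; apply: uniq_perm => [||E].
  - by rewrite (map_inj_uniq val_inj) enum_uniq.
  - exact: enum_uniq.
  - rewrite mem_enum; apply/mapP/idP => [[a _ ->]|EC]; first exact: valP.
    by exists (Sub E EC); rewrite ?mem_enum ?SubK.
by rewrite big_map big_enum.
Qed.

Lemma sum_pattern_weight_le A :
  \sum_(V : {set edge_set n} | V \subset C)
    pattern_weight p0 p1 (enum C) V * (pattern V \in A)%:R
  <= fine (Q (joint_vector Z @^-1` A)).
Proof.
pose D : {pred {set edge_set n}} :=
  [pred V : {set edge_set n} | (V \subset C) && (pattern V \in A)].
have D_inj : {in D &, injective pattern}.
  by move=> V V' /andP[VC _] /andP[V'C _]; apply: pattern_inj.
have DA V : V \in D -> A (pattern V) by move=> /andP[_ /set_mem].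
have mZ := measurable_joint Z.
have := sum_atoms_le Q (fun v => mZ [set v]) D_inj DA.
rewrite (eq_bigr (fun V => (pattern_weight p0 p1 (enum C) V)%:E)) => [|V _]; last first.
  exact: pattern_law.
rewrite sumEFin -[X in (_ <= X)%E](fineK (fin_num_measure Q _ (mZ A))) lee_fin.
apply: le_trans; rewrite [leRHS]big_mkcondr /=; apply: ler_sum => V _.
by case: ifP; rewrite ?mulr1 ?mulr0.
Qed.

Lemma cycle_indicators_one_sided A :
  fine (P (cycle_indicators C G @^-1` A)) - fine (Q (joint_vector Z @^-1` A)) <=
  \sum_(E in C) cycle_error R d r E.
Proof.
have p0_ge0 E : 0 <= p0 E by apply: expR_ge0.
have rate_ge0 := cycle_rate_ge0 R d_ge3.
have p1_ge0 E : 0 <= p1 E by rewrite mulr_ge0 ?expR_ge0.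
have p_le1 E : p0 E + p1 E <= 1.
  rewrite /p0 /p1 -[X in X + _]mul1r -mulrDl expRN ler_pdivrMr ?expR_gt0 // mul1r.
  exact: expR_ge1Dx.
have close E := poisson_weights_close (rate_ge0 n E).
pose f V : R := (pattern V \in A)%:R.
have f_le1 V : `|f V| <= 1 by rewrite ger0_norm ?lern1 ?leq_b1.
have := cycle_patterns_error C_short d_ge3 r_ge3 r_le d_le
  (fun E => (close E).1) (fun E => (close E).2) p0_ge0 p1_ge0 p_le1 f_le1.
have reg_gt0 : 0 < #|reg|%:R :> R by rewrite ltr0n (uniform_card_gt0 G_uniform).
move=> /(le_trans (ler_norm _)); rewrite lerBlDr => patterns_le.
rewrite cycle_indicators_law [fine _%:E]/= lerBlDr ler_pdivrMr // mulrDl.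
apply: le_trans patterns_le _; rewrite lerD2l mulrC ler_wpM2r //.
exact: sum_pattern_weight_le.
Qed.

Lemma dTV_cycle_indicators_le :
  dTV P Q (cycle_indicators C G) (joint_vector Z) <= \sum_(E in C) cycle_error R d r E.
Proof.
apply: dTV_le_one_sided; [exact: measurable_cycle_indicators|exact: measurable_joint|].
exact: cycle_indicators_one_sided.
Qed.

End TotalVariation.

Theorem theorem7 (R : realType) :
  exists2 C : R, 0 < C &
  forall (n d r : nat) (cI : {set edge_set n})
    (dO : measure_display) (Omega : measurableType dO)
    (P : probability Omega R) (G : Omega -> edge_set n)
    (dO2 : measure_display) (Omega2 : measurableType dO2)
    (Q : probability Omega2 R) (Z : cycle_index cI -> {RV Q >-> nat}),
  (odd d -> ~~ odd n) ->
  (3 <= d)%N -> (3 <= r)%N ->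
  r%:R <= n%:R `^ (10%:R^-1) :> R ->
  d%:R <= n%:R `^ (3%:R^-1) :> R ->
  uniform_on P (regular_graphs n d) G ->
  (forall alpha, alpha \in cI -> is_cycle alpha /\ (cycle_length alpha <= r)%N) ->
  (forall alpha : cycle_index cI, is_poisson (Z alpha)) ->
  (forall alpha : cycle_index cI,
     ('E_Q[fun w => (Z alpha w)%:R] =
      ((d%:R - 1) ^+ cycle_length (val alpha)
         / (n ^_ cycle_length (val alpha))%:R)%:E)%E) ->
  mutually_independent Z ->
  dTV P Q (cycle_indicators cI G) (joint_vector Z) <=
    \sum_(alpha in cI)
      C * (cycle_length alpha)%:R * (d%:R - 1) ^+ (cycle_length alpha + r - 1)
        / n%:R ^+ (cycle_length alpha + 1).
Proof.
exists 1212; first by rewrite ltr0n.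
move=> n d r cI dO Omega P G dO2 Omega2 Q Z _ d_ge3 r_ge3 r_le d_le G_unif cI_short.
move=> Z_poisson Z_mean Z_indep; apply: dTV_cycle_indicators_le => //.
- exact: le_powR_inv_nat r_le.
- exact: le_powR_inv_nat d_le.
Qed.
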